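(* Let $\mu>0$ and $k_0,k_1\in\mathbb{R}$ be fixed. There exists a constant $C>0$, independent of $L\ge1$, such that for any $\mathbf{u}\in\mathcal{W}_L$, $$\|\mathbf{u}\|^2_{L^4(\Omega_L)}\le C\|\mathbf{u}\|_{L^2(\Omega_L)}\|\nabla\mathbf{u}\|_{L^2(\Omega_L)}.$$
   Context: For $L\ge1$, $\Omega_L:=(-L,L)\times(0,1)\subset\mathbb{R}^2$; $\mathbf{n}$ is the unit outer normal and $\tau$ a unit tangent vector on (the sides of) $\partial\Omega_L$; $\mathbb{D}(\mathbf{v})=\frac12(\nabla\mathbf{v}+\nabla^T\mathbf{v})$. The slip coefficient $k$ on $\partial\Omega_L$ is given by $k(x,1)=k_1$, $k(x,0)=k_0$, $k(-L,y)=k(L,y)=0$. Set $\mathbf{V}_L:=\{\mathbf{v}\in H^1(\Omega_L)^2:\nabla\cdot\mathbf{v}=0,\ \mathbf{v}\cdot\mathbf{n}=0\text{ on }\partial\Omega_L\}$ and $\mathcal{W}_L:=\{\mathbf{v}\in\mathbf{V}_L\cap H^2(\Omega_L)^2: 2\mu\mathbb{D}(\mathbf{v})\mathbf{n}\cdot\tau=k(x,y)\mathbf{v}\cdot\tau\text{ on }\partial\Omega_L\}$. *)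

(* Defs.v *)
From HB Require Import structures.
From mathcomp Require Import all_boot all_order all_algebra.
From mathcomp Require Import all_classical all_reals all_analysis.

Set Implicit Arguments.
Unset Strict Implicit.
Unset Printing Implicit Defensive.

Import Order.TTheory GRing.Theory Num.Theory.
Import numFieldNormedType.Exports.

Local Open Scope classical_set_scope.
Local Open Scope ring_scope.

Notation leb1 := (@lebesgue_measure _).
Notation leb2 := (@lebesgue_measure _ \x @lebesgue_measure _)%E.

Definition vec2 (R : realType) (a b : R) : 'I_2 -> R :=
  fun i => if i == ord0 then a else b.

Definition dot2 (R : realType) (a b : 'I_2 -> R) : R := \sum_i a i * b i.

Definition evec (R : realType) (i : 'I_2) : R * R :=
  if i == ord0 then (1, 0) else (0, 1).

Definition Omega (R : realType) (L : R) : set (R * R) :=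
  `]-L, L[%classic `*` `]0, 1[%classic.

(* L^2(D), and the L^p(D) norm (with values in [0, +oo]); functions on D are
   represented by total functions, whose values outside D are discarded. *)
Definition inL2 d (T : measurableType d) (R : realType)
    (mu : {measure set T -> \bar R}) (D : set T) (f : T -> R) : Prop :=
  f \_ D \in Lfun mu 2%:E.

Definition normL d (T : measurableType d) (R : realType)
    (mu : {measure set T -> \bar R}) (p : R) (D : set T) (f : T -> R) : \bar R :=
  'N[mu]_(p%:E)[EFin \o (f \_ D)]%E.

Fixpoint Ck (R : realType) (k : nat) (f : R * R -> R) : Prop :=
  continuous f /\
  if k is k'.+1 then
    forall i : 'I_2, (forall p, derivable f p (evec R i)) /\
                     Ck k' (fun p => 'D_(evec R i) f p)
  else True.

Definition smooth (R : realType) (f : R * R -> R) : Prop := forall k, Ck k f.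

Definition test_fun (R : realType) (L : R) (phi : R * R -> R) : Prop :=
  smooth phi /\
  exists K : set (R * R),
    [/\ compact K, K `<=` Omega L & forall p, ~ K p -> phi p = 0].

Definition is_wderiv (R : realType) (L : R) (i : 'I_2) (f g : R * R -> R) : Prop :=
  inL2 leb2 (Omega L) g /\
  forall phi, test_fun L phi ->
    \int[leb2]_(p in Omega L) (f p * 'D_(evec R i) phi p) =
    - \int[leb2]_(p in Omega L) (g p * phi p).

(* A representative of the weak derivative, which is unique up to a.e.
   equality; meaningful only when an L^2 weak derivative exists. *)
Definition wderiv (R : realType) (L : R) (i : 'I_2) (f : R * R -> R) : R * R -> R :=
  xget (fun=> 0) [set g | is_wderiv L i f g].

Definition H1 (R : realType) (L : R) (f : R * R -> R) : Prop :=
  inL2 leb2 (Omega L) f /\ forall i, exists g, is_wderiv L i f g.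

Definition H2 (R : realType) (L : R) (f : R * R -> R) : Prop :=
  H1 L f /\ forall i, H1 L (wderiv L i f).

Definition cvgH1 (R : realType) (L : R) (phi : nat -> R * R -> R)
    (f : R * R -> R) : Prop :=
  (normL leb2 2 (Omega L) (fun p => phi n p - f p)%R @[n --> \oo] --> 0%E) /\
  forall i, normL leb2 2 (Omega L)
    (fun p => 'D_(evec R i) (phi n) p - wderiv L i f p)%R @[n --> \oo] --> 0%E.

(* The boundary of Omega L consists, up to the four corners, of the four open
   sides, each parametrised by arc length. *)
Inductive side := Left | Right | Bottom | Top.

Definition bpoint (R : realType) (L : R) (S : side) (s : R) : R * R :=
  match S with
  | Left => (- L, s) | Right => (L, s) | Bottom => (s, 0) | Top => (s, 1)
  end.

Definition bdom (R : realType) (L : R) (S : side) : set R :=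
  match S with
  | Left | Right => `]0, 1[%classic
  | Bottom | Top => `]-L, L[%classic
  end.

Definition normal (R : realType) (S : side) : 'I_2 -> R :=
  match S with
  | Left => vec2 (-1) 0 | Right => vec2 1 0
  | Bottom => vec2 0 (-1) | Top => vec2 0 1
  end.

(* The outer normal rotated by a right angle; the slip condition does not
   depend on the orientation chosen. *)
Definition tangent (R : realType) (S : side) : 'I_2 -> R :=
  vec2 (- normal R S (lift ord0 ord0)) (normal R S ord0).

Definition slip (R : realType) (k0 k1 : R) (S : side) : R :=
  match S with Left | Right => 0 | Bottom => k0 | Top => k1 end.

(* g is the trace on the boundary of the H^1 function f: the trace operator is
   the extension by continuity, from H^1 to L^2 of the boundary, of the
   restriction to the boundary of functions smooth up to the boundary. *)
Definition is_trace (R : realType) (L : R) (f g : R * R -> R) : Prop :=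
  (forall S, inL2 leb1 (bdom L S) (g \o bpoint L S)) /\
  exists phi : nat -> R * R -> R,
    [/\ forall n, smooth (phi n),
        cvgH1 L phi f &
        forall S, normL leb1 2 (bdom L S)
          (fun s => phi n (bpoint L S s) - g (bpoint L S s))%R
            @[n --> \oo] --> 0%E].

Definition ae_boundary (R : realType) (L : R) (P : side -> R * R -> Prop) : Prop :=
  forall S, {ae @lebesgue_measure R, forall s, bdom L S s -> P S (bpoint L S s)}.

Definition divergence (R : realType) (L : R) (v : 'I_2 -> R * R -> R)
    (p : R * R) : R :=
  \sum_i wderiv L i (v i) p.

(* Entry (i, j) of D(v) *)
Definition symgrad (R : realType) (L : R) (v : 'I_2 -> R * R -> R) (i j : 'I_2)
    (p : R * R) : R :=
  2^-1 * (wderiv L j (v i) p + wderiv L i (v j) p).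

Definition V (R : realType) (L : R) (v : 'I_2 -> R * R -> R) : Prop :=
  [/\ forall i, H1 L (v i),
      {ae leb2, forall p, Omega L p -> divergence L v p = 0} &
      exists2 g : 'I_2 -> R * R -> R,
        forall i, is_trace L (v i) (g i) &
        ae_boundary L (fun S b => dot2 (g^~ b) (normal R S) = 0)].

Definition W (R : realType) (mu k0 k1 L : R) (v : 'I_2 -> R * R -> R) : Prop :=
  [/\ V L v,
      forall i, H2 L (v i) &
      exists (g : 'I_2 -> R * R -> R) (e : 'I_2 -> 'I_2 -> R * R -> R),
        [/\ forall i, is_trace L (v i) (g i),
            forall i j, is_trace L (symgrad L v i j) (e i j) &
            ae_boundary L (fun S b =>
              2 * mu * dot2 (fun i => dot2 (e i ^~ b) (normal R S)) (tangent R S)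
              = slip k0 k1 S * dot2 (g^~ b) (tangent R S))]].

(* Euclidean norm |v| and Frobenius norm |grad v|, pointwise *)
Definition vabs (R : realType) (v : 'I_2 -> R * R -> R) (p : R * R) : R :=
  Num.sqrt (\sum_i v i p ^+ 2).

Definition gradabs (R : realType) (L : R) (v : 'I_2 -> R * R -> R) (p : R * R) : R :=
  Num.sqrt (\sum_i \sum_j wderiv L j (v i) p ^+ 2).

(* Main.v *)
(* Ladyzhenskaya's argument bounds the integral of f^4 over the rectangle by the
   product of the integrals of sup_x f^2 (in y) and of sup_y f^2 (in x), and a
   supremum over a segment is at most the value at one point plus 2 |f f'|
   integrated along the segment.  The constant does not depend on L as each
   component has a point where it is small on every segment: u_2 vanishes for
   y = 0, u_1 for x = - L, and u_1 has zero mean on every vertical segment since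
   u is divergence free and tangent to the boundary; for u_2 on horizontal
   segments the mean of u_2^2 is used, which is controlled by the vertical
   derivative.  These facts hold up to small errors for the smooth functions
   defining the trace.  The errors are removed first, at a fixed truncation
   level, which makes convergence in L^2 sufficient; the truncation is then
   removed by monotone convergence.  Products |f f'| are split as
   t f^2 + f'^2 / t, and t is optimised at the end. *)
Require Import Defs.
From HB Require Import structures.
From mathcomp Require Import all_boot all_order all_algebra.
From mathcomp Require Import all_classical all_reals all_analysis.
From mathcomp Require Import measurable_realfun ring lra.
Import Order.TTheory GRing.Theory Num.Theory.
Import numFieldNormedType.Exports.
Local Open Scope classical_set_scope.
Local Open Scope ring_scope.

(** * One-variable calculus on open intervals *)

Section OneVariable.
Context {R : realType}.
Implicit Types (g dg : R -> R) (a b x y : R).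

Lemma continuous_integrable_oo g a b : continuous g ->
  leb1.-integrable `]a, b[ (EFin \o g).
Proof.
move=> cg; apply: (@integrableS _ _ _ leb1 `[a, b]) => //; first exact: subset_itv_oo_cc.
apply: continuous_compact_integrable; first exact: segment_compact.
exact: continuous_subspaceT.
Qed.

Lemma continuous_Rintegral_oo_fin g a b : continuous g ->
  (\int[leb1]_(s in `]a, b[) (g s)%:E = (\int[leb1]_(s in `]a, b[) g s)%:E)%E.
Proof.
move=> cg; rewrite /Rintegral fineK//; apply: integrable_fin_num => //.
exact: continuous_integrable_oo.
Qed.

(** The end points form a null set; this links the open intervals of the domain and its sides to the
    closed segments of the fundamental theorem of calculus. *)
Lemma integral_oo_cc (g : R -> \bar R) a b : measurable_fun [set: R] g ->
  (\int[leb1]_(s in `]a, b[) g s = \int[leb1]_(s in `[a, b]) g s)%E.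
Proof.
move=> mg; rewrite integral_itv_obnd_cbnd; last exact: measurable_funTS.
by rewrite integral_itv_bndo_bndc//; exact: measurable_funTS.
Qed.

Lemma derive_continuous g dg : (forall x, is_derive x 1 g (dg x)) -> continuous g.
Proof.
move=> Dg x; apply: differentiable_continuous.
by apply/derivable1_diffP; case: (Dg x).
Qed.

Lemma FTC_oo g dg a b : a <= b -> continuous dg ->
  (forall x, is_derive x 1 g (dg x)) ->
  \int[leb1]_(s in `]a, b[) dg s = g b - g a.
Proof.
rewrite le_eqVlt => /predU1P[->|ab] cdg Dg.
  by rewrite set_itvoo0 Rintegral_set0 subrr.
apply: EFin_inj; rewrite -continuous_Rintegral_oo_fin// integral_oo_cc; last first.
  by apply/measurable_EFinP; exact: continuous_measurable_fun.
have cg := derive_continuous _ _ Dg.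
rewrite (@continuous_FTC2 _ dg g)//.
- exact: continuous_subspaceT.
- split => [x _| |]; first by case: (Dg x).
  + by apply: cvg_at_right_filter; exact: cg.
  + by apply: cvg_at_left_filter; exact: cg.
- by move=> x _; rewrite derive1E; have [] := Dg x.
Qed.

(** The mean value theorem for the primitive [F]. It supplies, on each segment, a point where a
    function equals its mean. *)
Lemma mean_value_integral g a b : a < b -> continuous g ->
  exists2 c, c \in `]a, b[ & \int[leb1]_(s in `]a, b[) g s = g c * (b - a).
Proof.
move=> ab cg.
pose F x := \int[leb1]_(s in `[a, x]) g s.
have ig x y : leb1.-integrable `[x, y] (EFin \o g).
  apply: continuous_compact_integrable; first exact: segment_compact.
  exact: continuous_subspaceT.
have [c cab cE] : exists2 c, c \in `]a, b[ & F b - F a = g c * (b - a).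
  apply: MVT => // [x xab|].
    have ax : a < x by move: xab; rewrite in_itv/= => /andP[].
    (* Any end point beyond [x] serves, since [g] is continuous on the whole line; [x + 1] is
       taken. *)
    have [dF F'] := @continuous_FTC1_closed R g a x (x + 1) (ltr_pwDr ltr01 (lexx x))
      (ig _ _) ax (cg x).
    by rewrite -F' derive1E; exact: DeriveDef.
  exact: parameterized_integral_continuous (ltW ab) (ig _ _).
exists c => //; rewrite -cE /F set_itv1 Rintegral_set1 subr0.
by apply: EFin_inj; rewrite -continuous_Rintegral_oo_fin// integral_oo_cc;
  [rewrite /Rintegral fineK//; exact: integrable_fin_num (ig _ _)|
   apply/measurable_EFinP; exact: continuous_measurable_fun].
Qed.

(* AM-GM: [|2 g g'| <= t g^2 + g'^2 / t] *)
Lemma sqr_le_sqr_add_integral g dg a b t x y : 0 < t ->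
  continuous dg -> (forall x, is_derive x 1 g (dg x)) ->
  a <= x <= b -> a <= y <= b ->
  ((g x ^+ 2)%:E <= (g y ^+ 2)%:E +
    \int[leb1]_(s in `]a, b[) (t * g s ^+ 2 + dg s ^+ 2 / t)%:E)%E.
Proof.
move=> t0 cdg Dg /andP[ax xb] /andP[ay yb].
have cg := derive_continuous _ _ Dg.
pose h s := 2 * g s * dg s; pose q s := t * g s ^+ 2 + dg s ^+ 2 / t.
have ch : continuous h.
  by move=> s; apply: cvgM; [apply: cvgM; [exact: cvg_cst|exact: cg]|exact: cdg].
have cq : continuous q.
  move=> s; apply: cvgD; apply: cvgM; try exact: cvg_cst.
    by apply: cvgM; exact: cg.
  by apply: cvgM; exact: cdg.
have q0 s : 0 <= q s.
  by rewrite addr_ge0// mulr_ge0// ?sqr_ge0// ?invr_ge0 ltW.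
have hq s : `|h s| <= q s.
  (* For [r] equal to 1 or -1 the last term vanishes and a square remains, which gives the two signs
     of the bound on [h s]. *)
  have E r : q s - 2 * r * g s * dg s = (t * g s - r * dg s) ^+ 2 / t +
      (1 - r ^+ 2) * dg s ^+ 2 / t.
    by rewrite /q; field; rewrite gt_eqF.
  have P r : r ^+ 2 = 1 -> 2 * r * g s * dg s <= q s.
    move=> r1; rewrite -subr_ge0 E r1 subrr !mul0r addr0.
    by rewrite divr_ge0 ?sqr_ge0// ltW.
  have Pp := P 1 (expr1n _ _).
  have Pm := P (-1) (etrans (sqrrN _) (expr1n _ _)).
  by rewrite ler_norml; apply/andP; split; rewrite /h; lra.
(* [h] is the derivative of [g ^+ 2] and is dominated by [q]; as [q] is nonnegative, the integral
   may be extended from []u, v[] to []a, b[]. *)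
have key u v : a <= u -> u <= v -> v <= b -> `|g v ^+ 2 - g u ^+ 2| <= \int[leb1]_(s in `]a, b[) q s.
  move=> au uv vb.
  have -> : g v ^+ 2 - g u ^+ 2 = \int[leb1]_(s in `]u, v[) h s.
    apply/esym/(@FTC_oo (fun s => g s ^+ 2)) => // s.
    have -> : (fun s => g s ^+ 2) = g * g by apply/funext => r; rewrite expr2.
    by apply: is_derive_eq; rewrite /h /GRing.scale/=; ring.
  rewrite (le_trans (le_normr_Rintegral _ _))//.
    exact: continuous_integrable_oo.
  apply: (@le_trans _ _ (\int[leb1]_(s in `]u, v[) q s)).
    apply: le_Rintegral => //; apply: continuous_integrable_oo => //.
    by move=> s; apply: cvg_norm; exact: ch.
  rewrite -lee_fin -!continuous_Rintegral_oo_fin//.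
  apply: ge0_subset_integral => //.
  - apply/measurable_EFinP; apply: measurable_funTS; exact: continuous_measurable_fun.
  - by move=> s _; rewrite lee_fin.
  - by apply: subset_itv; rewrite bnd_simp.
rewrite [X in (_ <= _ + X)%E](continuous_Rintegral_oo_fin q)// -EFinD lee_fin.
have [xy|/ltW yx] := leP x y.
- have := key _ _ ax xy yb; rewrite ler_norml; lra.
- have := key _ _ ay yx xb; rewrite ler_norml; lra.
Qed.

End OneVariable.

(** * Measurability in the plane and Tonelli's theorem on rectangles *)

Section TwoVariables.
Context {R : realType}.

(** An open set is the union of the squares with rational centre and rational radius that it
    contains; there are countably many of them, and each is a measurable product. *)
Lemma open_measurable2 (A : set (R * R)) : open A -> measurable A.
Proof.
move=> oA.
pose B (i : rat * rat * rat) : set (R * R) :=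
  ball (ratr i.1.1 : R) (ratr i.2) `*` ball (ratr i.1.2 : R) (ratr i.2).
have -> : A = \bigcup_(i in [set i | B i `<=` A]) B i.
  apply/seteqP; split => [[x y] Axy|p [i /= BA /BA]//].
  have /nbhs_ballP[_/posnumP[e] eA] : nbhs (x, y) A by exact: open_nbhs_nbhs.
  (* A radius below half of [e] is enough: the centre is within [d] of both [(x, y)] and any point
     of the square, so these differ by less than [e] in each coordinate. *)
  have /rat_in_itvoo[d /itvP dI] : 0 < e%:num / 2 by [].
  have d0 : 0 < ratr d :> R by rewrite dI.
  have appr (z : R) : exists q, `|z - ratr q| < ratr d.
    have /rat_in_itvoo[q] : z < z + ratr d by rewrite ltrDl.
    rewrite in_itv/= => /andP[zq qz].
    by exists q; rewrite distrC gtr0_norm ?subr_gt0 ?ltrBlDl.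
  have [q1 xq1] := appr x; have [q2 yq2] := appr y.
  exists (q1, q2, d); last by split; rewrite /= /ball/= distrC.
  move=> [u v] [/= uq1 vq2]; apply: eA; split; rewrite /ball/=.
  - rewrite (splitr e%:num).
    have -> : x - u = (x - ratr q1) + (ratr q1 - u) by ring.
    rewrite (le_lt_trans (ler_normD _ _))// ltrD//; [by apply: (lt_trans xq1); rewrite dI|].
    by apply: (lt_trans uq1); rewrite dI.
  - rewrite (splitr e%:num).
    have -> : y - v = (y - ratr q2) + (ratr q2 - v) by ring.
    rewrite (le_lt_trans (ler_normD _ _))// ltrD//; [by apply: (lt_trans yq2); rewrite dI|].
    by apply: (lt_trans vq2); rewrite dI.
rewrite bigcup_mkcond; apply: countable_bigcupT_measurable.
  exact: countableP.
by move=> i; case: ifP => // _; apply: measurableX; exact: measurable_ball.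
Qed.

Lemma continuous_measurable_fun2 (f : R * R -> R) :
  continuous f -> measurable_fun [set: R * R] f.
Proof.
move=> /continuousP cf; apply: (measurability _ (RGenOpens.measurableE R)).
move=> _ [_ [a [b ->] <-]]; rewrite setTI; apply: open_measurable2.
exact/cf/interval_open.
Qed.

Local Open Scope ereal_scope.
Variables (X Y : set R).
Hypotheses (mX : measurable X) (mY : measurable Y).
Variable F : R * R -> \bar R.
Hypotheses (mF : measurable_fun (X `*` Y) F)
           (F0 : forall p, (X `*` Y) p -> 0 <= F p).

Lemma tonelli_rect1 :
  \int[leb2]_(p in X `*` Y) F p = \int[leb1]_(x in X) \int[leb1]_(y in Y) F (x, y).
Proof.
rewrite integral_mkcond fubini_tonelli1; last 2 first.
- by apply/(measurable_restrictT _ _).1 => //; exact: measurableX.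
- by move=> p; apply: erestrict_ge0.
rewrite [RHS]integral_mkcond; apply: eq_integral => x _.
rewrite /fubini_F /patch; case: ifPn => xX.
  rewrite [RHS]integral_mkcond; apply: eq_integral => y _; rewrite /patch.
  by rewrite in_setX/= xX.
by apply: integral0_eq => y _; rewrite in_setX/= (negbTE xX).
Qed.

Lemma tonelli_rect2 :
  \int[leb2]_(p in X `*` Y) F p = \int[leb1]_(y in Y) \int[leb1]_(x in X) F (x, y).
Proof.
rewrite integral_mkcond fubini_tonelli2; last 2 first.
- by apply/(measurable_restrictT _ _).1 => //; exact: measurableX.
- by move=> p; apply: erestrict_ge0.
rewrite [RHS]integral_mkcond; apply: eq_integral => y _.
rewrite /fubini_G /patch; case: ifPn => yY.
  rewrite [RHS]integral_mkcond; apply: eq_integral => x _; rewrite /patch.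
  by rewrite in_setX/= yY andbT.
by apply: integral0_eq => x _; rewrite in_setX/= (negbTE yY) andbF.
Qed.

End TwoVariables.

(** * Measurability of integrals over slices *)

Section Slices.
Context {R : realType}.
Local Open Scope ereal_scope.
Variable F : R * R -> \bar R.
Hypotheses (mF : measurable_fun [set: R * R] F) (F0 : forall p, 0 <= F p).

Lemma measurable_integral_slice1 (Y : set R) : measurable Y ->
  measurable_fun [set: R] (fun x => \int[leb1]_(y in Y) F (x, y)).
Proof.
move=> mY; pose G := F \_ ([set: R] `*` Y).
have mG : measurable_fun [set: R * R] G.
  apply/(measurable_restrictT _ _).1; first exact: measurableX.
  exact: measurable_funTS.
have := @measurable_fun_fubini_tonelli_F _ _ _ _ R leb1 G mG.
rewrite (_ : fubini_F leb1 G = fun x => \int[leb1]_(y in Y) F (x, y)); last first.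
  apply/funext => x; rewrite /fubini_F [RHS]integral_mkcond.
  by apply: eq_integral => y _; rewrite /G /patch in_setX in_setT.
by apply=> p; apply: erestrict_ge0.
Qed.

Lemma measurable_integral_slice2 (X : set R) : measurable X ->
  measurable_fun [set: R] (fun y => \int[leb1]_(x in X) F (x, y)).
Proof.
move=> mX; pose G := F \_ (X `*` [set: R]).
have mG : measurable_fun [set: R * R] G.
  apply/(measurable_restrictT _ _).1; first exact: measurableX.
  exact: measurable_funTS.
have := @measurable_fun_fubini_tonelli_G _ _ _ _ R leb1 G mG.
rewrite (_ : fubini_G leb1 G = fun y => \int[leb1]_(x in X) F (x, y)); last first.
  apply/funext => y; rewrite /fubini_G [RHS]integral_mkcond.
  by apply: eq_integral => x _; rewrite /G /patch in_setX in_setT andbT.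
by apply=> p; apply: erestrict_ge0.
Qed.

End Slices.

(** * Partial derivatives as derivatives along slices *)

Section SliceDerivatives.
Context {R : realType}.
Implicit Types (f : R * R -> R) (x y : R).

Notation i1 := (lift ord0 ord0 : 'I_2).

(** The difference quotients of the slice and of [f] in the direction [evec R ord0] are the same
    function of [h]. *)
Lemma is_derive_slice1 f x y : derivable f (x, y) (evec R ord0) ->
  is_derive x 1 (fun s => f (s, y)) ('D_(evec R ord0) f (x, y)).
Proof.
have E : (fun h : R => h^-1 *: (((fun s => f (s, y)) \o shift x) (h *: 1) - f (x, y)))
    = (fun h : R => h^-1 *: ((f \o shift (x, y)) (h *: evec R ord0) - f (x, y))).
  apply/funext => h /=; congr (_ *: (f (_, _) - _)); rewrite /evec /=.
  by rewrite [h *: 0]mulr0 add0r.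
by move=> df; apply: DeriveDef; [rewrite /derivable E|rewrite /derive E].
Qed.

Lemma is_derive_slice2 f x y : derivable f (x, y) (evec R i1) ->
  is_derive y 1 (fun s => f (x, s)) ('D_(evec R i1) f (x, y)).
Proof.
have E : (fun h : R => h^-1 *: (((fun s => f (x, s)) \o shift y) (h *: 1) - f (x, y)))
    = (fun h : R => h^-1 *: ((f \o shift (x, y)) (h *: evec R i1) - f (x, y))).
  apply/funext => h /=; congr (_ *: (f (_, _) - _)); rewrite /evec /=.
  by rewrite [h *: 0]mulr0 add0r.
by move=> df; apply: DeriveDef; [rewrite /derivable E|rewrite /derive E].
Qed.

Lemma continuous_slice1 f y : continuous f -> continuous (fun x => f (x, y)).
Proof.
move=> cf x; apply: (@continuous_comp _ _ _ (fun x => (x, y)) f); last exact: cf.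
exact: cvg_pair cvg_id (cvg_cst _).
Qed.

Lemma continuous_slice2 f x : continuous f -> continuous (fun y => f (x, y)).
Proof.
move=> cf y; apply: (@continuous_comp _ _ _ (fun y => (x, y)) f); last exact: cf.
exact: cvg_pair (cvg_cst _) cvg_id.
Qed.

End SliceDerivatives.

(** * Ladyzhenskaya's argument and Fubini's theorem on a rectangle *)

Section Rectangle.
Context {R : realType}.
Variables (a b c d : R).
Let X := `]a, b[%classic.
Let Y := `]c, d[%classic.
Let mX : measurable X. Proof. exact: measurable_itv. Qed.
Let mY : measurable Y. Proof. exact: measurable_itv. Qed.
Let mXY : measurable (X `*` Y). Proof. exact: measurableX. Qed.

Local Open Scope ereal_scope.

Lemma integral_rect_tensor (A B : R -> \bar R) :
  measurable_fun [set: R] A -> measurable_fun [set: R] B ->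
  (forall x, 0 <= A x) -> (forall x, 0 <= B x) ->
  \int[leb2]_(p in X `*` Y) (A p.1 * B p.2) =
  \int[leb1]_(x in X) A x * \int[leb1]_(y in Y) B y.
Proof.
move=> mA mB A0 B0; rewrite tonelli_rect1//; last 2 first.
- apply: measurable_funTS; apply: emeasurable_funM; apply: measurableT_comp => //.
- by move=> p _; rewrite mule_ge0.
transitivity (\int[leb1]_(x in X) (A x * \int[leb1]_(y in Y) B y)).
  apply: eq_integral => x _ /=; rewrite -ge0_integralZl//.
  exact: measurable_funTS.
rewrite ge0_integralZr//; first exact: measurable_funTS.
exact: integral_ge0.
Qed.

Section Ladyzhenskaya.
Variables (f f1 f2 : R * R -> R) (t : R).
Hypotheses (cf : continuous f) (cf1 : continuous f1) (cf2 : continuous f2)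
  (Df1 : forall x y : R, is_derive x (1%R : R) (fun s => f (s, y)) (f1 (x, y)))
  (Df2 : forall x y : R, is_derive y (1%R : R) (fun s => f (x, s)) (f2 (x, y)))
  (t0 : (0 < t)%R).

(** By AM-GM, [Q] dominates the integrals of |2 f f1| and of |2 f f2| for every weight [t]; keeping
    [t] free replaces the Cauchy-Schwarz inequality. *)
Let Q : \bar R := \int[leb2]_(p in X `*` Y)
  (t * f p ^+ 2 + (f1 p ^+ 2 + f2 p ^+ 2) / t)%:E.

Let q (g : R * R -> R) p : \bar R := (t * f p ^+ 2 + g p ^+ 2 / t)%:E.

Let q0 g p : 0 <= q g p.
Proof. by rewrite lee_fin addr_ge0// mulr_ge0// ?sqr_ge0// ?invr_ge0 ltW. Qed.

Let mq g : continuous g -> measurable_fun [set: R * R] (q g).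
Proof.
move=> cg; apply/measurable_EFinP; apply: measurable_funD;
  apply: measurable_funM => //; apply: measurable_funX;
  exact: continuous_measurable_fun2.
Qed.

Let qQ g : g = f1 \/ g = f2 -> continuous g ->
  \int[leb2]_(p in X `*` Y) q g p <= Q.
Proof.
move=> gE cg; apply: ge0_le_integral => //.
- by apply: measurable_funTS; exact: mq.
- apply: measurable_funTS; apply/measurable_EFinP; apply: measurable_funD;
    apply: measurable_funM => //; first by
    apply: measurable_funX; exact: continuous_measurable_fun2.
  by apply: measurable_funD; apply: measurable_funX;
    exact: continuous_measurable_fun2.
- move=> p _; rewrite lee_fin lerD2l ler_pM2r ?invr_gt0//.
  by case: gE => ->; rewrite ?lerDl ?lerDr sqr_ge0.
Qed.

(** [al] and [be] bound [f ^+ 2] at one point of each horizontal and of each vertical segment.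
    Moving along the segment gives f^2 <= [A y] and f^2 <= [B x] everywhere, hence f^4 <=
    [B x * A y], whose integral factors. Each of the two factors is then bounded by Tonelli's
    theorem. *)
Lemma ladyzhenskaya_rect (al be : R -> \bar R) :
  measurable_fun [set: R] al -> measurable_fun [set: R] be ->
  (forall y, 0 <= al y) -> (forall x, 0 <= be x) ->
  (forall y, Y y -> exists2 x0, (a <= x0 <= b)%R & (f (x0, y) ^+ 2)%:E <= al y) ->
  (forall x, X x -> exists2 y0, (c <= y0 <= d)%R & (f (x, y0) ^+ 2)%:E <= be x) ->
  \int[leb2]_(p in X `*` Y) (f p ^+ 4)%:E <=
    (\int[leb1]_(x in X) be x + Q) * (\int[leb1]_(y in Y) al y + Q).
Proof.
move=> mal mbe al0 be0 Hal Hbe.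
pose B x := be x + \int[leb1]_(y in Y) q f2 (x, y).
pose A y := al y + \int[leb1]_(x in X) q f1 (x, y).
have mB : measurable_fun [set: R] B.
  by apply: emeasurable_funD => //; apply: measurable_integral_slice1 => //; exact: mq.
have mA : measurable_fun [set: R] A.
  by apply: emeasurable_funD => //; apply: measurable_integral_slice2 => //; exact: mq.
have B0 x : 0 <= B x by rewrite adde_ge0// integral_ge0.
have A0 x : 0 <= A x by rewrite adde_ge0// integral_ge0.
have IB : \int[leb1]_(x in X) B x <= \int[leb1]_(x in X) be x + Q.
  rewrite ge0_integralD//; last 3 first.
  - exact: measurable_funTS.
  - by move=> x _; rewrite integral_ge0.
  - by apply: measurable_funTS; apply: measurable_integral_slice1 => //; exact: mq.
  rewrite leeD2l// -tonelli_rect1//; last by apply: measurable_funTS; exact: mq.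
  by apply: qQ => //; right.
have IA : \int[leb1]_(y in Y) A y <= \int[leb1]_(y in Y) al y + Q.
  rewrite ge0_integralD//; last 3 first.
  - exact: measurable_funTS.
  - by move=> x _; rewrite integral_ge0.
  - by apply: measurable_funTS; apply: measurable_integral_slice2 => //; exact: mq.
  rewrite leeD2l// -tonelli_rect2//; last by apply: measurable_funTS; exact: mq.
  by apply: qQ => //; left.
apply: (@le_trans _ _ (\int[leb1]_(x in X) B x * \int[leb1]_(y in Y) A y)); last first.
  by apply: lee_pmul => //; exact: integral_ge0.
rewrite -integral_rect_tensor//; apply: ge0_le_integral => //.
- by move=> p _; rewrite lee_fin (@exprn_even_ge0 _ 4).
- apply: measurable_funTS; apply/measurable_EFinP; apply: measurable_funX.
  exact: continuous_measurable_fun2.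
- by apply: measurable_funTS; apply: emeasurable_funM; apply: measurableT_comp.
move=> [x y] [/= Xx Yy]; rewrite (exprM _ 2 2) expr2 EFinM /=.
have abx : (a <= x <= b)%R by move: (Xx); rewrite /X/= in_itv/= => /andP[/ltW-> /ltW->].
have cdy : (c <= y <= d)%R by move: (Yy); rewrite /Y/= in_itv/= => /andP[/ltW-> /ltW->].
apply: lee_pmul; rewrite ?lee_fin ?sqr_ge0//.
- have [y0 cdy0 fy0] := Hbe x Xx.
  have := sqr_le_sqr_add_integral (fun s => f (x, s)) (fun s => f2 (x, s)) _ _ _ _ _ t0
    (continuous_slice2 _ x cf2) (Df2 x) cdy cdy0.
  move/le_trans; apply; exact: leeD.
- have [x0 abx0 fx0] := Hal y Yy.
  have := sqr_le_sqr_add_integral (fun s => f (s, y)) (fun s => f1 (s, y)) _ _ _ _ _ t0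
    (continuous_slice1 _ y cf1) (Df1^~ y) abx abx0.
  move/le_trans; apply; exact: leeD.
Qed.

(** A Poincaré inequality in the vertical direction: each point is compared with the foot [(x, c)]
    of its segment. No factor depends on the width [b - a], which is what later gives uniformity in
    [L]. *)
Lemma integral_sqr_le : (c <= d)%R ->
  \int[leb2]_(p in X `*` Y) (f p ^+ 2)%:E <=
    (\int[leb1]_(x in X) (f (x, c) ^+ 2)%:E + Q) * (d - c)%:E.
Proof.
move=> cd; pose B x := (f (x, c) ^+ 2)%:E + \int[leb1]_(y in Y) q f2 (x, y).
have mfc : measurable_fun [set: R] (fun x => (f (x, c) ^+ 2)%:E).
  apply/measurable_EFinP; apply: measurable_funX; apply: continuous_measurable_fun.
  exact: continuous_slice1.
have mq2 : measurable_fun [set: R] (fun x => \int[leb1]_(y in Y) q f2 (x, y)).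
  by apply: measurable_integral_slice1 => //; exact: mq.
have mB : measurable_fun [set: R] B by exact: emeasurable_funD.
have B0 x : 0 <= B x by rewrite adde_ge0// ?lee_fin ?sqr_ge0// integral_ge0.
have IB : \int[leb1]_(x in X) B x <= \int[leb1]_(x in X) (f (x, c) ^+ 2)%:E + Q.
  rewrite ge0_integralD//; last 4 first.
  - by move=> x _; rewrite lee_fin sqr_ge0.
  - exact: measurable_funTS.
  - by move=> x _; rewrite integral_ge0.
  - exact: measurable_funTS.
  rewrite leeD2l// -tonelli_rect1//; last by apply: measurable_funTS; exact: mq.
  by apply: qQ => //; right.
apply: (@le_trans _ _ (\int[leb1]_(x in X) B x * (d - c)%:E)); last first.
  by rewrite lee_wpmul2r// lee_fin subr_ge0.
(* Written as the integral of 1, the height turns the bound into a tensor product; for [c = d] the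
   interval is empty and both sides are 0. *)
have -> : (d - c)%:E = \int[leb1]_(y in Y) (cst 1 y).
  rewrite integral_cst//= mul1e lebesgue_measure_itv/= lte_fin.
  by have [//|dc] := ltP c d; rewrite (@le_anti _ _ c d) ?cd// subrr.
rewrite -integral_rect_tensor//; apply: ge0_le_integral => //.
- by move=> p _; rewrite lee_fin sqr_ge0.
- apply: measurable_funTS; apply/measurable_EFinP; apply: measurable_funX.
  exact: continuous_measurable_fun2.
- by apply: measurable_funTS; apply: emeasurable_funM; apply: measurableT_comp.
move=> [x y] [/= Xx Yy]; rewrite mule1.
have cdy : (c <= y <= d)%R by move: (Yy); rewrite /Y/= in_itv/= => /andP[/ltW-> /ltW->].
apply: (sqr_le_sqr_add_integral (fun s => f (x, s)) (fun s => f2 (x, s))) => //.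
- exact: continuous_slice2.
- by rewrite lexx.
Qed.

End Ladyzhenskaya.

Lemma integrable_rect (h : R * R -> R) : continuous h ->
  leb2.-integrable (X `*` Y) (EFin \o h).
Proof.
move=> ch; apply: measurable_bounded_integrable => //.
- rewrite [ltLHS](@product_measure1E _ _ _ _ R leb1 leb1)//= /X /Y !lebesgue_measure_itv/=.
  by do 2 case: ifP => _; rewrite ?mul0e ?mule0// -!EFinD -EFinM ltry.
- by apply: measurable_funTS; exact: continuous_measurable_fun2.
- have : compact (h @` (`[a, b] `*` `[c, d])).
    apply: continuous_compact; first exact: continuous_subspaceT.
    by apply: compact_setX; exact: segment_compact.
  move=> /compact_bounded[M [Mreal hM]]; exists M; split=> // r Mr p [Xp Yp].
  apply: (hM _ Mr).
  by exists p => //; split; exact: subset_itv_oo_cc.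
Qed.

(** The integrand has no sign here, so the exchange rests on integrability: a continuous function is
    bounded on the closed rectangle. *)
Lemma Fubini_rect (h : R * R -> R) : continuous h ->
  \int[leb1]_(x in X) \int[leb1]_(y in Y) (h (x, y))%:E =
  \int[leb1]_(y in Y) \int[leb1]_(x in X) (h (x, y))%:E.
Proof.
move=> ch; pose H := (EFin \o h) \_ (X `*` Y).
have iH : leb2.-integrable setT H.
  by apply: (iffLR (@integrable_mkcond _ _ R leb2 _ (EFin \o h) mXY)); exact: integrable_rect.
transitivity (\int[leb1]_x \int[leb1]_y H (x, y)).
  rewrite integral_mkcond; apply: eq_integral => x _; rewrite /patch; case: ifPn => xX.
    rewrite integral_mkcond; apply: eq_integral => y _.
    by rewrite /H /patch in_setX/= xX.
  by apply/esym/integral0_eq => y _; rewrite /H /patch in_setX/= (negbTE xX).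
rewrite (Fubini iH).
rewrite [RHS]integral_mkcond; apply: eq_integral => y _; rewrite /patch; case: ifPn => yY.
  rewrite [RHS]integral_mkcond; apply: eq_integral => x _.
  by rewrite /H /patch in_setX/= yY andbT.
by apply/integral0_eq => x _; rewrite /H /patch in_setX/= (negbTE yY) andbF.
Qed.

Lemma measurable_integral_slice_continuous (h : R * R -> R) : continuous h ->
  measurable_fun X (fun x => \int[leb1]_(y in Y) (h (x, y))%:E).
Proof.
move=> ch; pose H := (EFin \o h) \_ (X `*` Y).
have /measurable_fubini_F mH : leb2.-integrable setT H.
  by apply: (iffLR (@integrable_mkcond _ _ R leb2 _ (EFin \o h) mXY)); exact: integrable_rect.
apply: (eq_measurable_fun (fubini_F leb1 H)).
  move=> x xX; rewrite [RHS]integral_mkcond; apply: eq_integral => y _.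
  by rewrite /H /patch in_setX/= xX.
exact: measurable_funTS.
Qed.

End Rectangle.

(** * Vertical means of the first component of a nearly divergence-free field *)

Section MeanBound.
Context {R : realType}.
Local Open Scope ereal_scope.

(** Flux balance for the field [(f, g)], whose divergence is [f1 + g2], on the part of the rectangle
    to the left of [x]: the flux through the vertical segment at [x] is the flux at [a], plus the
    integral of the divergence, minus the flux through top and bottom. The mean of [f] is thus small
    as soon as the other three terms are. *)
Lemma norm_integral_slice_le (a b c d x : R) (f f1 g g2 : R * R -> R) :
  continuous f -> continuous f1 -> continuous g -> continuous g2 ->
  (forall x y : R, is_derive x (1%R : R) (fun s => f (s, y)) (f1 (x, y))) ->
  (forall x y : R, is_derive y (1%R : R) (fun s => g (x, s)) (g2 (x, y))) ->
  (c <= d)%R -> (a <= x <= b)%R ->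
  `| \int[leb1]_(y in `]c, d[) (f (x, y))%:E | <=
    \int[leb1]_(y in `]c, d[) `|f (a, y)|%:E +
    (\int[leb2]_(p in `]a, b[ `*` `]c, d[) `|f1 p + g2 p|%:E +
     \int[leb1]_(s in `]a, b[) (`|g (s, d)| + `|g (s, c)|)%:E).
Proof.
move=> cf cf1 cg cg2 Df Dg cd /andP[ax xb].
have ch : continuous (fun p => f1 p + g2 p)%R.
  by move=> p; apply: cvgD; [exact: cf1|exact: cg2].
have mh : measurable_fun [set: R * R] (fun p => `|f1 p + g2 p|%:E).
  apply/measurable_EFinP; apply: measurableT_comp => //.
  exact: continuous_measurable_fun2.
have slice (h : R * R -> R) s : continuous h -> continuous (fun y => h (s, y)).
  exact: continuous_slice2.
have mg : measurable_fun [set: R] (fun s => (`|g (s, d)| + `|g (s, c)|)%:E).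
  by apply/measurable_EFinP; apply: measurable_funD; apply: measurableT_comp => //;
    apply: continuous_measurable_fun; exact: continuous_slice1.
have mhs : measurable_fun [set: R]
    (fun s => \int[leb1]_(y in `]c, d[) `|f1 (s, y) + g2 (s, y)|%:E).
  by apply: (measurable_integral_slice1 (fun p => `|f1 p + g2 p|%:E)) => // p;
    rewrite lee_fin.
(* The fundamental theorem of calculus along each horizontal segment from [a] to [x], after
   exchanging the order of integration. *)
have -> : \int[leb1]_(y in `]c, d[) (f (x, y))%:E =
    \int[leb1]_(y in `]c, d[) (f (a, y))%:E +
    \int[leb1]_(s in `]a, x[) \int[leb1]_(y in `]c, d[) (f1 (s, y))%:E.
  rewrite Fubini_rect// !continuous_Rintegral_oo_fin//; try exact: slice.
  under [X in _ + X]eq_integral => y _.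
    rewrite continuous_Rintegral_oo_fin; last exact: continuous_slice1.
    rewrite (FTC_oo (fun s => f (s, y)) (fun s => f1 (s, y)))//; last exact: continuous_slice1.
    over.
  rewrite continuous_Rintegral_oo_fin; last first.
    by move=> y; apply: cvgB; exact: slice.
  rewrite RintegralB//; try by apply: continuous_integrable_oo; exact: slice.
  by rewrite -EFinD addrC subrK.
rewrite (le_trans (lee_abs_add _ _))//; apply: leeD.
  apply: le_abse_integral => //; apply: measurable_funTS.
  by apply/measurable_EFinP; apply: continuous_measurable_fun; exact: slice.
rewrite (le_trans (le_abse_integral _ _ _))//; first exact: measurable_integral_slice_continuous.
(* [f1] is the divergence minus [g2], and [g2] integrates in [y] to the difference of [g] between
   top and bottom. *)
have cmp s : `|\int[leb1]_(y in `]c, d[) (f1 (s, y))%:E| <=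
    \int[leb1]_(y in `]c, d[) `|f1 (s, y) + g2 (s, y)|%:E +
    (`|g (s, d)| + `|g (s, c)|)%:E.
  have chs : continuous (fun y => f1 (s, y) + g2 (s, y))%R.
    exact: (slice _ s ch).
  rewrite !continuous_Rintegral_oo_fin//; [|by move=> y; apply: cvg_norm; exact: chs|exact: slice].
  rewrite -EFinD lee_fin.
  have -> : (\int[leb1]_(y in `]c, d[) f1 (s, y) =
      \int[leb1]_(y in `]c, d[) (f1 (s, y) + g2 (s, y)) - (g (s, d) - g (s, c)))%R.
    rewrite -(FTC_oo (fun y => g (s, y)) (fun y => g2 (s, y)))//; last exact: slice.
    rewrite RintegralD ?addrK//; apply: continuous_integrable_oo; exact: slice.
  rewrite (le_trans (ler_normB _ _))// lerD ?ler_normB//.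
  by apply: le_normr_Rintegral => //; exact: continuous_integrable_oo.
apply: (@le_trans _ _ (\int[leb1]_(s in `]a, x[)
    (\int[leb1]_(y in `]c, d[) `|f1 (s, y) + g2 (s, y)|%:E +
    (`|g (s, d)| + `|g (s, c)|)%:E))).
  apply: ge0_le_integral => //.
  - by apply: measurableT_comp => //; exact: measurable_integral_slice_continuous.
  - by apply: measurable_funTS; apply: emeasurable_funD.
(* The integrand is nonnegative, so enlarging the interval makes the bound independent of [x]. *)
apply: (@le_trans _ _ (\int[leb1]_(s in `]a, b[)
    (\int[leb1]_(y in `]c, d[) `|f1 (s, y) + g2 (s, y)|%:E +
    (`|g (s, d)| + `|g (s, c)|)%:E))).
  apply: ge0_subset_integral => //.
  - by apply: measurable_funTS; apply: emeasurable_funD.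
  - by move=> s _; rewrite adde_ge0// ?lee_fin ?addr_ge0//; apply: integral_ge0 => y _; rewrite lee_fin.
  - by apply: subset_itvl; rewrite bnd_simp.
rewrite ge0_integralD//.
- rewrite tonelli_rect1//; first exact: measurable_funTS.
- by move=> s _; apply: integral_ge0 => y _; rewrite lee_fin.
- exact: measurable_funTS.
- exact: measurable_funTS.
Qed.

(* AM-GM: [|h| <= e + h^2 / e] *)
Lemma integral_norm_le d (T : measurableType d) (mu : {measure set T -> \bar R})
    (D : set T) (h : T -> R) (e : R) : measurable D -> measurable_fun D h -> (0 < e)%R ->
  \int[mu]_(x in D) `|h x|%:E <=
  e%:E * mu D + (e^-1)%:E * \int[mu]_(x in D) (h x ^+ 2)%:E.
Proof.
move=> mD mh e0.
have mh2 : measurable_fun D (fun x => (h x ^+ 2)%:E).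
  by apply/measurable_EFinP; exact: measurable_funX.
rewrite -integral_cst// -ge0_integralZl//; last 2 first.
- by move=> x _; rewrite lee_fin sqr_ge0.
- by rewrite lee_fin invr_ge0 ltW.
rewrite -ge0_integralD//; last 3 first.
- by move=> x _; rewrite lee_fin ltW.
- by move=> x _; rewrite mule_ge0// lee_fin ?sqr_ge0// invr_ge0 ltW.
- exact: measurable_funeM.
apply: ge0_le_integral => //.
- by apply/measurable_EFinP; exact: measurableT_comp.
- by apply: emeasurable_funD => //; exact: measurable_funeM.
move=> x _; rewrite -EFinM -EFinD lee_fin -(@ler_pM2l _ e)// mulrDr mulVKf ?gt_eqF//.
have := sqr_ge0 (`|h x| - e / 2); have := sqr_ge0 e; have := real_normK (num_real (h x)); nra.
Qed.

End MeanBound.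

Local Notation d0 := (ord0 : 'I_2).
Local Notation d1 := (lift ord0 ord0 : 'I_2).

(** * L^4 bounds for smooth functions satisfying the constraints up to an error [e] *)

Section SmoothEstimate.
Context {R : realType}.
Local Open Scope ereal_scope.

(** The weighted majorant [Q] of the rectangle estimate, taken with the partial derivatives of [f]
    itself. *)
Definition energy (L t : R) (f : R * R -> R) : \bar R :=
  \int[leb2]_(p in Omega L)
    (t * f p ^+ 2 + ('D_(evec R d0) f p ^+ 2 + 'D_(evec R d1) f p ^+ 2) / t)%:E.

Lemma energy_density_ge0 (t u v w : R) : (0 < t)%R ->
  0 <= (t * u ^+ 2 + (v ^+ 2 + w ^+ 2) / t)%:E.
Proof.
move=> t0; rewrite lee_fin addr_ge0//.
  by rewrite mulr_ge0 ?sqr_ge0// ltW.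
by rewrite divr_ge0 ?addr_ge0 ?sqr_ge0// ltW.
Qed.

Lemma energy_ge0 (L t : R) (f : R * R -> R) : (0 < t)%R -> 0 <= energy L t f.
Proof. by move=> t0; apply: integral_ge0 => p _; exact: energy_density_ge0. Qed.

Section Smooth.
Variable f : R * R -> R.
Hypothesis sf : smooth f.

Lemma smooth_continuous : continuous f.
Proof. by have [] := sf 0%N. Qed.

Lemma smooth_derivable i p : derivable f p (evec R i).
Proof. by have [_ /(_ i)[+ _]] := sf 1%N; exact. Qed.

Lemma smooth_continuous_derive i : continuous (fun p => 'D_(evec R i) f p).
Proof. by have [_ /(_ i)[_ []]] := sf 1%N. Qed.

End Smooth.

Section Estimate.
Variables (L t e q : R) (f g : R * R -> R).
Hypotheses (L1 : (1 <= L)%R) (t0 : (0 < t)%R) (e0 : (0 < e)%R)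
  (sf : smooth f) (sg : smooth g).

Let X : set R := [set` `](- L)%R, L[%R].
Let Y := [set` `](0 : R)%R, 1%R[%R].

Let mX : measurable X. Proof. exact: measurable_itv. Qed.
Let mY : measurable Y. Proof. exact: measurable_itv. Qed.

Let muX : lebesgue_measure X = (2 * L)%:E.
Proof.
rewrite lebesgue_measure_itv/= lte_fin gtrN ?(lt_le_trans ltr01)//.
by rewrite -EFinD; congr EFin; ring.
Qed.

Let muY : lebesgue_measure Y = 1.
Proof. by rewrite lebesgue_measure_itv/= lte_fin ltr01 -EFinD subr0. Qed.

Let muO : leb2 (Omega L) = (2 * L)%:E.
Proof.
rewrite [LHS](@product_measure1E _ _ _ _ R leb1 leb1)//=.
by rewrite [X in X * _]muX [X in _ * X]muY mule1.
Qed.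

Let mO : measurable (Omega L). Proof. exact: measurableX. Qed.

Let LL : (- L <= L)%R. Proof. by have := L1; lra. Qed.

(** The reference points are the left end on horizontal segments and, on vertical segments, a point
    where [f] equals its mean, of size O(e) by flux balance. The coefficient of [e ^+ 2] grows with
    [L], which is harmless: [e] tends to 0 with [L] fixed. The term [2 * q] gives the bound the same
    form as for the second component. *)
Lemma smooth_normal1_L4 :
  \int[leb1]_(y in Y) (f (- L, y) ^+ 2)%:E <= (e ^+ 2)%:E ->
  \int[leb1]_(x in X) (g (x, 0) ^+ 2)%:E <= (e ^+ 2)%:E ->
  \int[leb1]_(x in X) (g (x, 1) ^+ 2)%:E <= (e ^+ 2)%:E ->
  \int[leb2]_(p in Omega L) (('D_(evec R d0) f p + 'D_(evec R d1) g p) ^+ 2)%:E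
    <= (4 * e ^+ 2)%:E ->
  energy L t f <= q%:E ->
  \int[leb2]_(p in Omega L) (f p ^+ 4)%:E <=
    (((1 + 2 * L * (8 + 6 * L) ^+ 2) * e ^+ 2 + 2 * q) ^+ 2)%:E.
Proof.
move=> fL g0 g1 fg Eq.
have cf := smooth_continuous _ sf; have cg := smooth_continuous _ sg.
(* The mean of [f] over a vertical segment is at most [2 e] (left side)
   [+ (2 L + 4) e] (divergence) [+ 2 (2 L + 1) e] (bottom and top). *)
pose M : R := ((8 + 6 * L) * e)%R.
(* AM-GM with the weight [e] itself balances the two terms: e m + (r e^2) / e = (m + r) e. *)
have AMGM d (T : measurableType d) (mu : {measure set T -> \bar R}) D (h : T -> R) (m r : R) :
    measurable D -> measurable_fun D h -> mu D = m%:E ->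
    \int[mu]_(x in D) (h x ^+ 2)%:E <= (r * e ^+ 2)%:E ->
    \int[mu]_(x in D) `|h x|%:E <= ((m + r) * e)%:E.
  move=> mD mh muD hr; rewrite (le_trans (integral_norm_le _ _ _ _ _ e _ _ _))//.
  rewrite muD -EFinM; apply: (@le_trans _ _ ((e * m)%:E + (e^-1)%:E * (r * e ^+ 2)%:E)).
    by rewrite leeD2l// lee_wpmul2l// lee_fin invr_ge0 ltW.
  rewrite -EFinM -EFinD lee_fin le_eqVlt; apply/orP; left; apply/eqP; field.
  by rewrite gt_eqF.
have mean x : X x -> (`|\int[leb1]_(y in Y) f (x, y)| <= M)%R.
  move=> Xx; rewrite -lee_fin.
  have xL : (- L <= x <= L)%R by move: Xx; rewrite /X/= in_itv/= => /andP[/ltW-> /ltW->].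
  have := norm_integral_slice_le (-L)%R L 0%R 1%R x f (fun p => 'D_(evec R d0) f p)
    g (fun p => 'D_(evec R d1) g p) cf (smooth_continuous_derive _ sf _) cg
    (smooth_continuous_derive _ sg _)
    (fun x y => is_derive_slice1 _ x y (smooth_derivable _ sf _ _))
    (fun x y => is_derive_slice2 _ x y (smooth_derivable _ sg _ _)) ler01 xL.
  rewrite continuous_Rintegral_oo_fin; last exact: continuous_slice2.
  rewrite abse_EFin => /le_trans; apply.
  have mgs s : measurable_fun X (fun x => g (x, s)).
    by apply: measurable_funTS; apply: continuous_measurable_fun; exact: continuous_slice1.
  have mgs' s : measurable_fun X (fun x => `|g (x, s)|%:E).
    by apply/measurable_EFinP; exact: measurableT_comp.
  under [X in _ + (_ + X)]eq_integral => s _ do rewrite EFinD.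
  rewrite [X in _ + (_ + X)]ge0_integralD//; try exact: mgs'; try by move=> ? _; rewrite lee_fin.
  have -> : M = ((1 + 1) * e + ((2 * L + 4) * e + ((2 * L + 1) * e + (2 * L + 1) * e)))%R.
    by rewrite /M; ring.
  rewrite 3!EFinD; apply: leeD; last apply: leeD; last apply: leeD.
  - apply: AMGM => //; last by rewrite mul1r.
    by apply: measurable_funTS; apply: continuous_measurable_fun; exact: continuous_slice2.
  - apply: AMGM => //; apply: measurable_funTS; apply: continuous_measurable_fun2.
    by move=> p; apply: cvgD; exact: smooth_continuous_derive.
  - by apply: AMGM => //; [exact: mgs|rewrite mul1r].
  - by apply: AMGM => //; [exact: mgs|rewrite mul1r].
have M0 : (0 <= M)%R by rewrite mulr_ge0 ?ltW//; have := L1; lra.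
have q0 : (0 <= q)%R.
  by rewrite -lee_fin (le_trans _ Eq)//; exact: energy_ge0.
apply: (le_trans (ladyzhenskaya_rect (-L)%R L 0%R 1%R f _ _ t cf
    (smooth_continuous_derive _ sf _) (smooth_continuous_derive _ sf _)
    (fun x y => is_derive_slice1 _ x y (smooth_derivable _ sf _ _))
    (fun x y => is_derive_slice2 _ x y (smooth_derivable _ sf _ _)) t0
    (fun y => (f (-L, y) ^+ 2)%:E) (cst (M ^+ 2)%:E) _ _ _ _ _ _)) => //.
- apply/measurable_EFinP; apply: measurable_funX; apply: continuous_measurable_fun.
  exact: continuous_slice2.
- by move=> y; rewrite lee_fin sqr_ge0.
- by move=> x; rewrite lee_fin sqr_ge0.
- by move=> y _; exists (-L)%R => //; rewrite lexx LL.
(* A vertical segment has length one, so the integral of [f] over it is its mean, attained at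
   [y0]. *)
- move=> x Xx; have [y0 y01 y0E] :=
    mean_value_integral _ _ _ ltr01 (continuous_slice2 _ x cf).
  exists y0; first by move: y01; rewrite in_itv/= => /andP[/ltW-> /ltW->].
  move: y0E; rewrite subr0 mulr1 => <-; rewrite lee_fin -[leLHS]real_normK ?num_real//.
  by rewrite lerXn2r ?nnegrE//; exact: mean.
rewrite integral_cst// [X in _ * X + _]muX -EFinM [in leRHS]expr2 [leRHS]EFinM.
have Kq (r : R) : (r <= (1 + 2 * L * (8 + 6 * L) ^+ 2) * e ^+ 2)%R ->
  r%:E + energy L t f <= ((1 + 2 * L * (8 + 6 * L) ^+ 2) * e ^+ 2 + 2 * q)%:E.
  by move=> rK; rewrite EFinD leeD ?lee_fin// (le_trans Eq)// lee_fin; lra.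
apply: lee_pmul.
- rewrite adde_ge0 ?lee_fin//; first by rewrite mulr_ge0 ?sqr_ge0//; have := L1; lra.
  exact: energy_ge0.
- rewrite adde_ge0//; last exact: energy_ge0.
  by apply: integral_ge0 => p _; rewrite lee_fin sqr_ge0.
- apply: Kq; rewrite /M exprMn; have := sqr_ge0 e; lra.
- apply: le_trans (Kq (e ^+ 2)%R _); first exact: leeD2r.
  rewrite -[leLHS]mul1r ler_wpM2r ?sqr_ge0// lerDl !mulr_ge0 ?exprn_ge0//; have := L1; lra.
Qed.

(** On vertical segments the reference point is the bottom one, where [g] is small. On horizontal
    segments it is a point where [g ^+ 2] equals its mean [al y]; the integral of [al] is controlled
    by the vertical Poincaré inequality, at the cost of a second copy of the energy, whence
    [2 * q]. *)
Lemma smooth_normal2_L4 :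
  \int[leb1]_(x in X) (g (x, 0) ^+ 2)%:E <= (e ^+ 2)%:E ->
  energy L t g <= q%:E ->
  \int[leb2]_(p in Omega L) (g p ^+ 4)%:E <=
    (((1 + 2 * L * (8 + 6 * L) ^+ 2) * e ^+ 2 + 2 * q) ^+ 2)%:E.
Proof.
move=> g0 Eq.
have cg := smooth_continuous _ sg.
have E0 : 0 <= energy L t g by exact: energy_ge0.
have q0 : (0 <= q)%R by rewrite -lee_fin (le_trans _ Eq).
have L20 : (0 < 2 * L)%R by have := L1; lra.
pose al y := ((2 * L)^-1)%:E * \int[leb1]_(x in X) (g (x, y) ^+ 2)%:E.
have mg2 : measurable_fun [set: R * R] (fun p => (g p ^+ 2)%:E).
  apply/measurable_EFinP; apply: measurable_funX; exact: continuous_measurable_fun2.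
have g20 p : 0 <= (g p ^+ 2)%:E by rewrite lee_fin sqr_ge0.
have al0 y : 0 <= al y.
  by apply: mule_ge0; [rewrite lee_fin invr_ge0 ltW|exact: integral_ge0].
have mI : measurable_fun [set: R] (fun y => \int[leb1]_(x in X) (g (x, y) ^+ 2)%:E).
  by apply: (measurable_integral_slice2 (fun p => (g p ^+ 2)%:E) mg2 g20); exact: mX.
apply: (le_trans (ladyzhenskaya_rect (-L)%R L 0%R 1%R g _ _ t cg
    (smooth_continuous_derive _ sg _) (smooth_continuous_derive _ sg _)
    (fun x y => is_derive_slice1 _ x y (smooth_derivable _ sg _ _))
    (fun x y => is_derive_slice2 _ x y (smooth_derivable _ sg _ _)) t0
    al (fun x => (g (x, 0) ^+ 2)%:E) _ _ _ _ _ _)) => //.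
- exact: measurable_funeM.
- apply/measurable_EFinP; apply: measurable_funX; apply: continuous_measurable_fun.
  exact: continuous_slice1.
- move=> y _; have cg2 : continuous (fun x => g (x, y) ^+ 2)%R.
    by move=> x; apply: cvgM; exact: continuous_slice1.
  have LL' : (- L < L)%R by have := L1; lra.
  have [x0 x0L x0E] := mean_value_integral _ _ _ LL' cg2.
  exists x0; first by move: x0L; rewrite in_itv/= => /andP[/ltW-> /ltW->].
  rewrite /al continuous_Rintegral_oo_fin// x0E -EFinM lee_fin.
  have -> : (L - - L = 2 * L)%R by ring.
  by rewrite [leRHS]mulrC mulfK// gt_eqF.
- by move=> x _; exists 0%R => //; rewrite lexx ler01.
have Ial : \int[leb1]_(y in Y) al y <= (e ^+ 2)%:E + energy L t g.
  rewrite /al ge0_integralZl//; last 3 first.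
  - exact: measurable_funTS.
  - by move=> y _; exact: integral_ge0.
  - by rewrite lee_fin invr_ge0 ltW.
  rewrite -(tonelli_rect2 _ _ _ _ (fun p => (g p ^+ 2)%:E))//; last exact: measurable_funTS.
  have H : \int[leb2]_(p in X `*` Y) (g p ^+ 2)%:E <=
      (\int[leb1]_(x in X) (g (x, 0) ^+ 2)%:E + energy L t g) * (1 - 0)%:E.
    exact: (integral_sqr_le (-L)%R L 0%R 1%R g _ _ t cg
      (smooth_continuous_derive _ sg _) (smooth_continuous_derive _ sg _)
      (fun x y => is_derive_slice2 _ x y (smooth_derivable _ sg _ _)) t0 ler01).
  rewrite subr0 mule1 in H.
  (* Here [1 <= L] makes the factor [(2 * L)^-1] at most 1, so that the coefficient of the energy is
     uniform in [L]. *)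
  apply: (@le_trans _ _ (1 * \int[leb2]_(p in X `*` Y) (g p ^+ 2)%:E)).
    rewrite lee_wpmul2r// ?lee_fin ?invf_le1//; last by have := L1; lra.
    exact: integral_ge0.
  by rewrite mul1e; apply: (le_trans H); apply: leeD2r.
have e2 : (e ^+ 2 <= (1 + 2 * L * (8 + 6 * L) ^+ 2) * e ^+ 2)%R.
  rewrite -[leLHS]mul1r ler_wpM2r ?sqr_ge0// lerDl !mulr_ge0 ?exprn_ge0//; have := L1; lra.
rewrite [in leRHS]expr2 [leRHS]EFinM; apply: lee_pmul.
- by rewrite adde_ge0// integral_ge0.
- by rewrite adde_ge0// integral_ge0.
- rewrite EFinD; apply: leeD; first by rewrite (le_trans g0)// lee_fin.
  by rewrite (le_trans Eq)// lee_fin; lra.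
- apply: (@le_trans _ _ ((e ^+ 2)%:E + q%:E + q%:E)); first by apply: leeD => //; apply: (le_trans Ial); exact: leeD2l.
  by rewrite -!EFinD lee_fin; lra.
Qed.

End Estimate.
End SmoothEstimate.

(** * Norms as integrals, and truncation *)

Section Norms.
Context {d} {T : measurableType d} {R : realType} (mu : {measure set T -> \bar R}).
Implicit Types (D : set T) (f g h : T -> R).
Local Open Scope ereal_scope.

Lemma normLE n D f : (0 < n)%N ->
  normL mu n%:R D f = (\int[mu]_(x in D) (`|f x| ^+ n)%:E) `^ n%:R^-1.
Proof.
move=> n0; rewrite /normL unlock; congr (_ `^ _).
rewrite [RHS]integral_mkcond; apply: eq_integral => x _ /=.
rewrite /patch; case: ifPn => _ /=; first by rewrite powR_mulrn.
by rewrite normr0 powR0// pnatr_eq0 -lt0n.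
Qed.

Lemma integral_sqr_le_normL D f (e : R) : normL mu 2 D f < e%:E ->
  \int[mu]_(x in D) (f x ^+ 2)%:E <= (e ^+ 2)%:E.
Proof.
rewrite (@normLE 2)//; under eq_integral do rewrite real_normK ?num_real//.
have : 0 <= \int[mu]_(x in D) (f x ^+ 2)%:E.
  by apply: integral_ge0 => x _; rewrite lee_fin sqr_ge0.
case: (\int[mu]_(x in D) _) => [r| |]//; last first.
  by rewrite poweRyr ?invr_neq0.
rewrite !lee_fin poweR_EFin lte_fin => r0 re.
have <- : ((r `^ 2^-1) ^+ 2 = r)%R.
  by rewrite -powR_mulrn ?powR_ge0// -powRrM mulVf// powRr1.
by rewrite lerXn2r ?nnegrE ?powR_ge0// ltW// (le_lt_trans _ re)// powR_ge0.
Qed.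

Lemma inL2_measurable D f : measurable D -> inL2 mu D f -> measurable_fun D f.
Proof.
move=> mD /sub_Lfun_mfun; rewrite inE/= => mf.
exact/(measurable_restrictT _ mD).2.
Qed.

Lemma inL2_integral_sqr_lty D f : inL2 mu D f ->
  \int[mu]_(x in D) (f x ^+ 2)%:E < +oo.
Proof.
move=> /Lfun2_integrable_sqr /integrableP[_]; apply: le_lt_trans.
rewrite integral_mkcond le_eqVlt; apply/orP; left; apply/eqP.
apply: eq_integral => x _ /=; rewrite /patch; case: ifPn => _ /=.
  by rewrite ger0_norm ?sqr_ge0.
by rewrite expr0n/= normr0.
Qed.

Lemma integral_sqrD_le D f g : measurable D -> measurable_fun D f -> measurable_fun D g ->
  \int[mu]_(x in D) ((f x + g x) ^+ 2)%:E <=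
  2%:E * (\int[mu]_(x in D) (f x ^+ 2)%:E + \int[mu]_(x in D) (g x ^+ 2)%:E).
Proof.
move=> mD mf mg.
have m2 h : measurable_fun D h -> measurable_fun D (fun x => (h x ^+ 2)%:E).
  by move=> mh; apply/measurable_EFinP; exact: measurable_funX.
have sq0 h x : D x -> 0 <= (h x ^+ 2)%:E by rewrite lee_fin sqr_ge0.
rewrite -ge0_integralD//; [|exact: sq0|exact: m2|exact: sq0|exact: m2].
rewrite -ge0_integralZl//; last 2 first.
- by apply: emeasurable_funD; exact: m2.
- by move=> x _; rewrite adde_ge0// lee_fin sqr_ge0.
apply: ge0_le_integral => //.
- exact: sq0.
- by apply: m2; exact: measurable_funD.
- by apply: measurable_funeM; apply: emeasurable_funD; exact: m2.
move=> x _; rewrite -EFinD -EFinM lee_fin; have := sqr_ge0 (f x - g x); lra.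
Qed.

Lemma integral_sqr_le_approx D f g : measurable D -> measurable_fun D f -> measurable_fun D g ->
  \int[mu]_(x in D) (f x ^+ 2)%:E <=
  2%:E * (\int[mu]_(x in D) (g x ^+ 2)%:E + \int[mu]_(x in D) ((f x - g x) ^+ 2)%:E).
Proof.
move=> mD mf mg; have := integral_sqrD_le D g (f \- g)%R mD mg (measurable_funB mf mg).
apply: le_trans; rewrite le_eqVlt; apply/orP; left; apply/eqP.
by apply: eq_integral => x _ /=; rewrite addrC subrK.
Qed.

(** Since it is bounded by [K], the fourth power of a truncation is at most [K ^+ 2] times its
    square; an L^2 error then suffices to control an integral of fourth powers. *)
Definition truncation (K : R) f (x : T) : R := Num.min `|f x|%R K.

Lemma measurable_truncation D f K : measurable_fun D f -> measurable_fun D (truncation K f).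
Proof. by move=> mf; apply: measurable_minr => //; exact: measurableT_comp. Qed.

(* Where [|f - g| <= |g|] the truncation is at most [2 |g|]; elsewhere it is
   at most [min (2 |f - g|) K]. *)
Lemma truncation_le K f g x : (0 <= K)%R ->
  (truncation K f x ^+ 4 <= 16 * g x ^+ 4 + 4 * K ^+ 2 * (f x - g x) ^+ 2)%R.
Proof.
move=> K0; set m := truncation K f x.
have m0 : (0 <= m)%R by rewrite /m /truncation le_min normr_ge0.
have mf : (m <= `|f x|)%R by rewrite /m /truncation ge_min lexx.
have mK : (m <= K)%R by rewrite /m /truncation ge_min lexx orbT.
have fg : (`|f x| <= `|g x| + `|f x - g x|)%R.
  by rewrite -{1}(subrK (g x) (f x)) addrC ler_normD.
have g4 : (g x ^+ 4 = `|g x| ^+ 4)%R by rewrite -normrX ger0_norm// (@exprn_even_ge0 _ 4).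
have s2 : ((f x - g x) ^+ 2 = `|f x - g x| ^+ 2)%R by rewrite real_normK ?num_real.
rewrite g4 s2; move: (normr_ge0 (g x)) (normr_ge0 (f x - g x)%R) fg.
move: (Num.norm (g x)) (Num.norm (f x - g x)%R) => G S G0 S0 fg.
have [SG|/ltW GS] := leP S G.
  have : (m ^+ 4 <= (2 * G) ^+ 4)%R by rewrite lerXn2r ?nnegrE//; lra.
  rewrite exprMn => /le_trans; apply.
  have -> : (2 ^+ 4 = 16 :> R)%R by ring.
  by rewrite lerDl !mulr_ge0 ?exprn_ge0.
have m2 : (m ^+ 2 <= (2 * S) ^+ 2)%R by rewrite lerXn2r ?nnegrE//; lra.
have m2K : (m ^+ 2 <= K ^+ 2)%R by rewrite lerXn2r ?nnegrE//; lra.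
have : (m ^+ 4 <= (2 * S) ^+ 2 * K ^+ 2)%R.
  by rewrite (exprM _ 2 2) [leLHS]expr2 ler_pM// sqr_ge0.
move/le_trans; apply; rewrite exprMn.
have -> : (2 ^+ 2 * S ^+ 2 * K ^+ 2 = 4 * K ^+ 2 * S ^+ 2)%R by ring.
by rewrite lerDr mulr_ge0// exprn_ge0.
Qed.

(** Monotone convergence: the truncations increase with [n], and at each point they equal the
    absolute value of [f x] as soon as [n] exceeds it. *)
Lemma integral_truncation_cvg D f (B : \bar R) : measurable D -> measurable_fun D f ->
  (forall n : nat, \int[mu]_(x in D) (truncation n%:R f x ^+ 4)%:E <= B) ->
  \int[mu]_(x in D) (f x ^+ 4)%:E <= B.
Proof.
move=> mD mf H.
have mt n : measurable_fun D (fun x => (truncation n%:R f x ^+ 4)%:E).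
  by apply/measurable_EFinP; apply: measurable_funX; exact: measurable_truncation.
have t0 n x : (0 <= truncation n%:R f x)%R by rewrite le_min normr_ge0 ler0n.
have : \int[mu]_(x in D) (truncation n%:R f x ^+ 4)%:E @[n --> \oo] -->
    \int[mu]_(x in D) limn (fun n => (truncation n%:R f x ^+ 4)%:E).
  apply: cvg_monotone_convergence => //.
  - by move=> n x _; rewrite lee_fin exprn_ge0.
  - move=> x _ m n mn; rewrite lee_fin lerXn2r ?nnegrE//.
    by rewrite /truncation le_min !ge_min lexx /= ler_nat mn orbT.
have -> : \int[mu]_(x in D) limn (fun n => (truncation n%:R f x ^+ 4)%:E) =
    \int[mu]_(x in D) (f x ^+ 4)%:E.
  apply: eq_integral => x _; apply/cvg_lim => //; apply: cvg_near_cst.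
  near=> n; congr EFin; rewrite /truncation min_l.
    by rewrite -normrX ger0_norm// (@exprn_even_ge0 _ 4).
  by near: n; exact: nbhs_infty_ger.
move=> c; have <- := cvg_lim (@ereal_hausdorff R) c.
by apply: lime_le; [apply/cvg_ex; eexists; exact: c|exact: nearW].
Unshelve. all: by end_near.
Qed.

End Norms.

(** The weight t = sqrt (H / F) makes both terms equal to sqrt (F H), and the square of their sum is
    4 F H. As [F] or [H] may vanish, both are first increased by a small [n]. *)
Lemma le_of_le_weighted {R : realType} (A F H k : R) :
  0 <= F -> 0 <= H -> 0 <= k ->
  (forall t, 0 < t -> A <= k * (t * F + H / t) ^+ 2) -> A <= 4 * k * F * H.
Proof.
move=> F0 H0 k0 h.
have key n : 0 < n -> A <= 4 * k * (F + n) * (H + n).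
  move=> n0; have Fn : 0 < F + n by rewrite ltr_wpDl.
  have Hn : 0 < H + n by rewrite ltr_wpDl.
  pose t := Num.sqrt ((H + n) / (F + n)).
  have t0 : 0 < t by rewrite sqrtr_gt0 divr_gt0.
  have t2 : t ^+ 2 = (H + n) / (F + n) by rewrite sqr_sqrtr// ltW// divr_gt0.
  apply: (le_trans (h t t0)).
  have -> : 4 * k * (F + n) * (H + n) = k * (t * (F + n) + (H + n) / t) ^+ 2.
    have -> : (t * (F + n) + (H + n) / t) ^+ 2 =
        t ^+ 2 * (F + n) ^+ 2 + 2 * (F + n) * (H + n) + (H + n) ^+ 2 / t ^+ 2.
      by field; rewrite gt_eqF.
    by rewrite t2; field; rewrite !gt_eqF.
  have x0 : 0 <= t * F + H / t by rewrite addr_ge0 ?mulr_ge0 ?invr_ge0// ltW.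
  have xy : t * F + H / t <= t * (F + n) + (H + n) / t.
    by apply: lerD; [rewrite ler_pM2l// lerDl ltW|rewrite ler_pM2r ?invr_gt0// lerDl ltW].
  by rewrite ler_wpM2l// lerXn2r// nnegrE (le_trans x0).
apply/ler_addgt0Pr => e e0.
(* For [n <= 1], [c] bounds the coefficient of [n] in the excess over 4 k F H; the final 1 keeps it
   positive when [k] is 0. *)
pose c := 4 * k * (F + H + 1) + 1.
have c0 : 0 < c by rewrite ltr_wpDl// !mulr_ge0// !addr_ge0.
pose n := Num.min 1 (e / c).
have n0 : 0 < n by rewrite lt_min ltr01 divr_gt0.
have n1 : n <= 1 by rewrite ge_min lexx.
have nc : n * c <= e by rewrite -ler_pdivlMr// ge_min lexx orbT.
apply: (le_trans (key n n0)).
have -> : 4 * k * (F + n) * (H + n) = 4 * k * F * H + n * (4 * k * (F + H + n)) by ring.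
rewrite lerD2l; apply: le_trans nc; rewrite ler_wpM2l ?(ltW n0)// /c.
have : k * n <= k by rewrite ler_piMr.
by move=> ?; lra.
Qed.

(** * Smooth approximation of H^1 functions together with their traces *)

Section Approximation.
Context {R : realType}.
Local Open Scope ereal_scope.

Lemma is_wderiv_wderiv (L : R) i (f : R * R -> R) : H1 L f ->
  is_wderiv L i f (wderiv L i f).
Proof. by move=> [_ /(_ i) H]; exact: xgetPex. Qed.

Lemma cvg0_near_lt (a : nat -> \bar R) (e : R) : (0 < e)%R ->
  a n @[n --> \oo] --> 0 -> \forall n \near \oo, a n < e%:E.
Proof.
move=> e0 c; apply: (c [set x | x < e%:E]).
by apply: open_ereal_lt'; rewrite lte_fin.
Qed.

(** The conditions concern the function, two derivatives and four sides; being finitely many, they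
    hold together for one large index of the sequence that defines the trace. *)
Lemma trace_approx (L e : R) (u g : R * R -> R) : (0 < e)%R -> is_trace L u g ->
  exists f : R * R -> R, [/\ smooth f,
    \int[leb2]_(p in Omega L) ((f p - u p) ^+ 2)%:E <= (e ^+ 2)%:E,
    forall j, \int[leb2]_(p in Omega L)
      (('D_(evec R j) f p - wderiv L j u p) ^+ 2)%:E <= (e ^+ 2)%:E &
    forall S, \int[leb1]_(s in bdom L S)
      ((f (bpoint L S s) - g (bpoint L S s)) ^+ 2)%:E <= (e ^+ 2)%:E].
Proof.
move=> e0 [_ [phi [sphi [c0 c1] cb]]].
have n0 := cvg0_near_lt _ _ e0 c0.
have n1 : \forall n \near \oo, forall j, normL leb2 2 (Omega L)
    (fun p => 'D_(evec R j) (phi n) p - wderiv L j u p)%R < e%:E.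
  by apply: filter_forall => j; exact: cvg0_near_lt.
have nb S := cvg0_near_lt _ _ e0 (cb S).
near \oo => n.
exists (phi n); split => //.
- by apply: integral_sqr_le_normL; near: n.
- move=> j; apply: integral_sqr_le_normL; move: j; near: n; exact: n1.
- move=> S; apply: integral_sqr_le_normL; case: S.
  + near: n; exact: nb Left.
  + near: n; exact: nb Right.
  + near: n; exact: nb Bottom.
  + near: n; exact: nb Top.
Unshelve. all: by end_near.
Qed.

Lemma smooth_measurable (f : R * R -> R) D : smooth f -> measurable_fun D f.
Proof.
move=> sf; apply: measurable_funTS; apply: continuous_measurable_fun2.
exact: smooth_continuous.
Qed.

Lemma smooth_measurable_derive (f : R * R -> R) D i : smooth f ->
  measurable_fun D (fun p => 'D_(evec R i) f p).
Proof.
move=> sf; apply: measurable_funTS; apply: continuous_measurable_fun2.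
exact: smooth_continuous_derive.
Qed.

Lemma measurable_Omega (L : R) : measurable (Omega L).
Proof. exact: measurableX. Qed.

Lemma energyE (L t : R) (f : R * R -> R) : (0 < t)%R -> smooth f ->
  energy L t f = t%:E * \int[leb2]_(p in Omega L) (f p ^+ 2)%:E +
   (t^-1)%:E * (\int[leb2]_(p in Omega L) ('D_(evec R d0) f p ^+ 2)%:E +
                \int[leb2]_(p in Omega L) ('D_(evec R d1) f p ^+ 2)%:E).
Proof.
move=> t0 sf; have mO := measurable_Omega L.
have m2 (h : R * R -> R) : measurable_fun (Omega L) h -> measurable_fun (Omega L) (fun p => (h p ^+ 2)%:E).
  by move=> mh; apply/measurable_EFinP; exact: measurable_funX.
have mf := m2 _ (smooth_measurable _ (Omega L) sf).
have mD i := m2 _ (smooth_measurable_derive _ (Omega L) i sf).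
have sq0 (h : R * R -> R) p : Omega L p -> 0 <= (h p ^+ 2)%:E by rewrite lee_fin sqr_ge0.
have ti : (0 <= t^-1)%R by rewrite invr_ge0 ltW.
rewrite -ge0_integralD//; [|exact: sq0|exact: mD|exact: sq0|exact: mD].
have sqD0 p : Omega L p ->
    0 <= ('D_(evec R d0) f p ^+ 2)%:E + ('D_(evec R d1) f p ^+ 2)%:E.
  by move=> _; rewrite adde_ge0// lee_fin sqr_ge0.
have mDD := emeasurable_funD (mD d0) (mD d1).
have /= E1 := ge0_integralZl_EFin leb2 mO (sq0 f) mf (ltW t0).
have /= E2 := ge0_integralZl_EFin leb2 mO sqD0 mDD ti.
have F1 p : Omega L p -> 0 <= t%:E * (f p ^+ 2)%:E.
  by move=> Op; rewrite mule_ge0 ?sq0// lee_fin ltW.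
have F2 p : Omega L p -> 0 <= (t^-1)%:E *
    (('D_(evec R d0) f p ^+ 2)%:E + ('D_(evec R d1) f p ^+ 2)%:E).
  by move=> Op; rewrite mule_ge0 ?sqD0// lee_fin.
have /= E3 := ge0_integralD leb2 mO F1 (measurable_funeM t%:E mf)
  F2 (measurable_funeM (t^-1)%:E mDD).
rewrite -E1 -E2 -E3.
by apply: eq_integral => p _; rewrite [X in (_ + X)%:E]mulrC EFinD !EFinM EFinD.
Qed.

(** Each square is at most twice the square of the limit plus twice the error. In the coefficient of
    [e ^+ 2], [t] comes from the function and [2 / t] from its two derivatives. *)
Lemma energy_le_approx (L t e F H : R) (f u : R * R -> R) : (0 < t)%R -> smooth f ->
  H1 L u ->
  \int[leb2]_(p in Omega L) (u p ^+ 2)%:E <= F%:E ->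
  \int[leb2]_(p in Omega L) (wderiv L d0 u p ^+ 2)%:E +
  \int[leb2]_(p in Omega L) (wderiv L d1 u p ^+ 2)%:E <= H%:E ->
  \int[leb2]_(p in Omega L) ((f p - u p) ^+ 2)%:E <= (e ^+ 2)%:E ->
  (forall j, \int[leb2]_(p in Omega L)
    (('D_(evec R j) f p - wderiv L j u p) ^+ 2)%:E <= (e ^+ 2)%:E) ->
  energy L t f <= (2 * (t * F + H / t) + 2 * (t + 2 / t) * e ^+ 2)%:E.
Proof.
move=> t0 sf Hu uF wH fu Dw; have mO := measurable_Omega L.
have mu_ := inL2_measurable leb2 _ _ mO Hu.1.
have mw j := inL2_measurable leb2 _ _ mO (is_wderiv_wderiv _ j _ Hu).1.
have approx (h v : R * R -> R) : measurable_fun (Omega L) h -> measurable_fun (Omega L) v ->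
    \int[leb2]_(p in Omega L) ((h p - v p) ^+ 2)%:E <= (e ^+ 2)%:E ->
    \int[leb2]_(p in Omega L) (h p ^+ 2)%:E <=
    2%:E * (\int[leb2]_(p in Omega L) (v p ^+ 2)%:E + (e ^+ 2)%:E).
  move=> mh mv hv; rewrite (le_trans (integral_sqr_le_approx leb2 _ _ _ mO mh mv))//.
  by rewrite lee_wpmul2l ?lee_fin// leeD2l.
have ti : (0 <= t^-1)%R by rewrite invr_ge0 ltW.
rewrite energyE//.
apply: (@le_trans _ _ (t%:E * (2%:E * (F%:E + (e ^+ 2)%:E)) +
    (t^-1)%:E * (2%:E * (H%:E + (e ^+ 2)%:E + (e ^+ 2)%:E)))); last first.
  rewrite -!EFinD lee_fin le_eqVlt; apply/orP; left; apply/eqP.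
  by field; rewrite gt_eqF.
apply: leeD; rewrite lee_wpmul2l ?lee_fin ?(ltW t0)//.
- apply: (le_trans (approx _ _ (smooth_measurable _ _ sf) mu_ fu)).
  by rewrite lee_wpmul2l ?lee_fin// leeD2r.
- have A0 := approx _ _ (smooth_measurable_derive _ _ d0 sf) (mw d0) (Dw d0).
  have A1 := approx _ _ (smooth_measurable_derive _ _ d1 sf) (mw d1) (Dw d1).
  apply: (le_trans (leeD A0 A1)).
  rewrite -ge0_muleDr; last 2 first.
  + by rewrite adde_ge0 ?lee_fin ?sqr_ge0// integral_ge0// => p _; rewrite lee_fin sqr_ge0.
  + by rewrite adde_ge0 ?lee_fin ?sqr_ge0// integral_ge0// => p _; rewrite lee_fin sqr_ge0.
  rewrite lee_wpmul2l ?lee_fin// addeACA addeA; apply: leeD2r; exact: leeD2r.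
Qed.

End Approximation.

Lemma ae_mono d (T : measurableType d) (R : realType) (mu : {measure set T -> \bar R})
  (P Q : T -> Prop) : (forall x, P x -> Q x) ->
  {ae mu, forall x, P x} -> {ae mu, forall x, Q x}.
Proof. by move=> PQ; apply: filterS. Qed.

(** * L^4 bounds for the two components of a field in [V] *)

Section Components.
Context {R : realType}.
Local Open Scope ereal_scope.

Lemma measurable_bdom (L : R) S : measurable (bdom L S).
Proof. by case: S; exact: measurable_itv. Qed.

Lemma measurable_smooth_bpoint (L : R) S (f : R * R -> R) D : smooth f ->
  measurable_fun D (fun s => f (bpoint L S s)).
Proof.
move=> sf; apply: measurable_funTS; apply: continuous_measurable_fun.
have cf := smooth_continuous _ sf.
by case: S => /=; by [exact: continuous_slice1|exact: continuous_slice2].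
Qed.

(** Where the trace vanishes, the distance of [f] to the trace is the size of [f] itself. *)
Lemma boundary_sqr_le (L r : R) S (f g : R * R -> R) : smooth f ->
  inL2 leb1 (bdom L S) (g \o bpoint L S) ->
  {ae leb1, forall s, bdom L S s -> g (bpoint L S s) = 0%R} ->
  \int[leb1]_(s in bdom L S) ((f (bpoint L S s) - g (bpoint L S s)) ^+ 2)%:E <= r%:E ->
  \int[leb1]_(s in bdom L S) (f (bpoint L S s) ^+ 2)%:E <= r%:E.
Proof.
move=> sf g2 g0; apply: le_trans; rewrite le_eqVlt; apply/orP; left; apply/eqP.
have mD := measurable_bdom L S.
have mf := measurable_smooth_bpoint L S f (bdom L S) sf.
have mg : measurable_fun (bdom L S) (fun s => g (bpoint L S s)).
  exact: (inL2_measurable leb1 _ _ mD g2).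
apply: ge0_ae_eq_integral => //.
- by apply/measurable_EFinP; exact: measurable_funX.
- by apply/measurable_EFinP; apply: measurable_funX; exact: measurable_funB.
- by move=> s _; rewrite lee_fin sqr_ge0.
- by move=> s _; rewrite lee_fin sqr_ge0.
- by move: g0; apply: ae_mono => s /= gs Ds; rewrite gs// subr0.
Qed.

Lemma truncation_integral_le (L K : R) (u f : R * R -> R) : (0 <= K)%R ->
  measurable_fun (Omega L) u -> measurable_fun (Omega L) f ->
  \int[leb2]_(p in Omega L) (truncation K u p ^+ 4)%:E <=
  16%:E * \int[leb2]_(p in Omega L) (f p ^+ 4)%:E +
  (4 * K ^+ 2)%:E * \int[leb2]_(p in Omega L) ((f p - u p) ^+ 2)%:E.
Proof.
move=> K0 mu_ mf; have mO := measurable_Omega L.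
have f40 p : Omega L p -> 0 <= (f p ^+ 4)%:E by rewrite lee_fin (@exprn_even_ge0 _ 4).
have fu0 p : Omega L p -> 0 <= ((f p - u p) ^+ 2)%:E by rewrite lee_fin sqr_ge0.
have mf4 : measurable_fun (Omega L) (fun p => (f p ^+ 4)%:E).
  by apply/measurable_EFinP; exact: measurable_funX.
have mfu : measurable_fun (Omega L) (fun p => ((f p - u p) ^+ 2)%:E).
  by apply/measurable_EFinP; apply: measurable_funX; exact: measurable_funB.
have k0 : (0 <= 4 * K ^+ 2)%R by rewrite mulr_ge0// sqr_ge0.
have k16 : (0 <= 16 :> R)%R by [].
have /= E1 := ge0_integralZl_EFin leb2 mO f40 mf4 k16.
have /= E2 := ge0_integralZl_EFin leb2 mO fu0 mfu k0.
have F1 p : Omega L p -> 0 <= 16%:E * (f p ^+ 4)%:E.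
  by move=> Op; rewrite mule_ge0 ?f40// lee_fin.
have F2 p : Omega L p -> 0 <= (4 * K ^+ 2)%:E * ((f p - u p) ^+ 2)%:E.
  by move=> Op; rewrite mule_ge0 ?fu0// lee_fin.
have /= E3 := ge0_integralD leb2 mO F1 (measurable_funeM 16%:E mf4)
  F2 (measurable_funeM (4 * K ^+ 2)%:E mfu).
rewrite -E1 -E2 -E3; apply: ge0_le_integral => //.
- by move=> p _; rewrite lee_fin (@exprn_even_ge0 _ 4).
- by apply/measurable_EFinP; apply: measurable_funX; exact: measurable_truncation.
- by apply: emeasurable_funD; exact: measurable_funeM.
move=> p _; rewrite -!EFinM -EFinD lee_fin -[X in (_ + _ * X)%R]sqrrN opprB.
exact: truncation_le.
Qed.

Variables (L t F H : R) (u : 'I_2 -> R * R -> R).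
Hypotheses (L1 : (1 <= L)%R) (t0 : (0 < t)%R) (Vu : V L u)
  (uF : forall i, \int[leb2]_(p in Omega L) (u i p ^+ 2)%:E <= F%:E)
  (uH : forall i, \int[leb2]_(p in Omega L) (wderiv L d0 (u i) p ^+ 2)%:E +
    \int[leb2]_(p in Omega L) (wderiv L d1 (u i) p ^+ 2)%:E <= H%:E).

(** Both components are approximated within [e] by smooth [f] and [h]. These inherit the boundary
    conditions and the zero divergence up to [e], so the smooth estimates apply. *)
Lemma truncation_component_le (e K : R) i : (0 < e)%R -> (0 <= K)%R ->
  \int[leb2]_(p in Omega L) (truncation K (u i) p ^+ 4)%:E <=
  (16 * ((1 + 2 * L * (8 + 6 * L) ^+ 2) * e ^+ 2 +
     2 * (2 * (t * F + H / t) + 2 * (t + 2 / t) * e ^+ 2)) ^+ 2 +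
   4 * K ^+ 2 * e ^+ 2)%:E.
Proof.
move=> e0 K0; have [uH1 divu [g trg gn]] := Vu.
have mO := measurable_Omega L.
have [f [sf fu Df fb]] := trace_approx _ _ _ _ e0 (trg d0).
have [h [sh hu Dh hb]] := trace_approx _ _ _ _ e0 (trg d1).
have L2u j := (uH1 j).1.
have mu_ j : measurable_fun (Omega L) (u j) := inL2_measurable leb2 _ _ mO (L2u j).
(* Common end of both cases: a bound for a smooth [v] close to [u j] passes to the truncation of
   [u j], at the price of a factor 16 and of the error [4 * K ^+ 2 * e ^+ 2]. *)
have fin (v : R * R -> R) j : smooth v ->
    \int[leb2]_(p in Omega L) (v p ^+ 4)%:E <=
      (((1 + 2 * L * (8 + 6 * L) ^+ 2) * e ^+ 2 +
     2 * (2 * (t * F + H / t) + 2 * (t + 2 / t) * e ^+ 2)) ^+ 2)%:E ->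
    \int[leb2]_(p in Omega L) ((v p - u j p) ^+ 2)%:E <= (e ^+ 2)%:E ->
    \int[leb2]_(p in Omega L) (truncation K (u j) p ^+ 4)%:E <=
  (16 * ((1 + 2 * L * (8 + 6 * L) ^+ 2) * e ^+ 2 +
     2 * (2 * (t * F + H / t) + 2 * (t + 2 / t) * e ^+ 2)) ^+ 2 +
   4 * K ^+ 2 * e ^+ 2)%:E.
  move=> sv v4 vu; apply: (le_trans (truncation_integral_le L K _ v K0 (mu_ j)
    (smooth_measurable _ _ sv))).
  set A := ((_ + _) ^+ 2)%R in v4 *.
  apply: (@le_trans _ _ (16%:E * A%:E + (4 * K ^+ 2)%:E * (e ^+ 2)%:E)) => //.
  by apply: leeD; apply: lee_wpmul2l => //; rewrite lee_fin mulr_ge0// sqr_ge0.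
(* On each side the normal is plus or minus a coordinate vector, so the condition on the normal
   trace concerns a single component. *)
have bz S j : {ae leb1, forall s, bdom L S s -> dot2 (g^~ (bpoint L S s)) (normal R S) = 0%R} ->
    (forall b, dot2 (g^~ b) (normal R S) = 0%R -> g j b = 0%R) ->
    {ae leb1, forall s, bdom L S s -> g j (bpoint L S s) = 0%R}.
  by move=> + gj; apply: ae_mono => s + Ds => /(_ Ds) /gj.
have dotE (a b : 'I_2 -> R) : dot2 a b = (a d0 * b d0 + a d1 * b d1)%R.
  by rewrite /dot2 big_ord_recl big_ord1.
have fL : \int[leb1]_(y in `]0%R, 1%R[) (f (- L, y)%R ^+ 2)%:E <= (e ^+ 2)%:E.
  apply: (boundary_sqr_le L _ Left f (g d0) sf ((trg d0).1 Left) (bz Left d0 (gn Left) _) (fb Left)).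
  by move=> b; rewrite dotE /normal /vec2/= mulr0 addr0 mulrN1 => /eqP; rewrite oppr_eq0 => /eqP.
have h0 : \int[leb1]_(x in `](- L)%R, L[) (h (x, 0)%R ^+ 2)%:E <= (e ^+ 2)%:E.
  apply: (boundary_sqr_le L _ Bottom h (g d1) sh ((trg d1).1 Bottom) (bz Bottom d1 (gn Bottom) _) (hb Bottom)).
  by move=> b; rewrite dotE /normal /vec2/= mulr0 add0r mulrN1 => /eqP; rewrite oppr_eq0 => /eqP.
have h1 : \int[leb1]_(x in `](- L)%R, L[) (h (x, 1)%R ^+ 2)%:E <= (e ^+ 2)%:E.
  apply: (boundary_sqr_le L _ Top h (g d1) sh ((trg d1).1 Top) (bz Top d1 (gn Top) _) (hb Top)).
  by move=> b; rewrite dotE /normal /vec2/= mulr0 add0r mulr1.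
have mw k j : measurable_fun (Omega L) (wderiv L j (u k)).
  exact: (inL2_measurable leb2 _ _ mO (is_wderiv_wderiv _ _ _ (uH1 k)).1).
(* The divergence of [u] vanishes almost everywhere, so that of [(f, h)] equals the sum of the two
   approximation errors; the square of a sum costs a factor 2, hence 2 (e^2 + e^2). *)
have fh : \int[leb2]_(p in Omega L) (('D_(evec R d0) f p + 'D_(evec R d1) h p) ^+ 2)%:E
    <= (4 * e ^+ 2)%:E.
  pose v p := ('D_(evec R d0) f p - wderiv L d0 (u d0) p)%R.
  pose w p := ('D_(evec R d1) h p - wderiv L d1 (u d1) p)%R.
  have mDf := smooth_measurable_derive _ (Omega L) d0 sf.
  have mDh := smooth_measurable_derive _ (Omega L) d1 sh.
  have mv : measurable_fun (Omega L) v by exact: measurable_funB.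
  have mw' : measurable_fun (Omega L) w by exact: measurable_funB.
  have -> : \int[leb2]_(p in Omega L) (('D_(evec R d0) f p + 'D_(evec R d1) h p) ^+ 2)%:E =
      \int[leb2]_(p in Omega L) ((v p + w p) ^+ 2)%:E.
    apply: ge0_ae_eq_integral => //.
    - by apply/measurable_EFinP; apply: measurable_funX; exact: (measurable_funD mDf mDh).
    - by apply/measurable_EFinP; apply: measurable_funX; exact: (measurable_funD mv mw').
    - by move=> p _; rewrite lee_fin sqr_ge0.
    - by move=> p _; rewrite lee_fin sqr_ge0.
    - move: divu; apply: ae_mono => p /= + Op => /(_ Op).
      rewrite /divergence big_ord_recl big_ord1 /v /w => wz.
      by congr ((_ ^+ 2)%:E); rewrite addrACA -opprD wz subr0.
  apply: (le_trans (integral_sqrD_le leb2 _ _ _ mO mv mw')).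
  apply: (@le_trans _ _ (2%:E * ((e ^+ 2)%:E + (e ^+ 2)%:E))).
    by apply: lee_wpmul2l; [rewrite lee_fin|exact: (leeD (Df d0) (Dh d1))].
  by rewrite -EFinD -EFinM lee_fin; lra.
have Ef := energy_le_approx _ _ _ _ _ _ _ t0 sf (uH1 d0) (uF d0) (uH d0) fu Df.
have Eh := energy_le_approx _ _ _ _ _ _ _ t0 sh (uH1 d1) (uF d1) (uH d1) hu Dh.
have [->|->] : i = d0 \/ i = d1.
  by case: i => [[|[|//]] ilt]; [left|right]; exact: val_inj.
- apply: (fin f) => //.
  exact: (smooth_normal1_L4 L t e _ f h L1 t0 e0 sf sh fL h0 h1 fh Ef).
- apply: (fin h) => //.
  exact: (smooth_normal2_L4 L t e _ h L1 t0 sh h0 Eh).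
Qed.

(** First [e] tends to 0 at a fixed truncation level [n], then [n] tends to infinity. The constant
    is 16 * 4^2: 16 from truncation, 4 from the two successive factors 2 in front of
    [t * F + H / t]. *)
Lemma component_L4_le i :
  \int[leb2]_(p in Omega L) (u i p ^+ 4)%:E <= (256 * (t * F + H / t) ^+ 2)%:E.
Proof.
have [uH1 _ _] := Vu.
have F0 : (0 <= F)%R.
  rewrite -lee_fin (le_trans _ (uF d0))// integral_ge0// => p _.
  by rewrite lee_fin sqr_ge0.
have H0 : (0 <= H)%R.
  rewrite -lee_fin (le_trans _ (uH d0))// adde_ge0// integral_ge0// => p _;
  by rewrite lee_fin sqr_ge0.
apply: integral_truncation_cvg.
- exact: measurable_Omega.
- exact: (inL2_measurable leb2 _ _ (measurable_Omega L) (uH1 i).1).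
move=> n; apply/lee_addgt0Pr => r r0.
set q := (t * F + H / t)%R.
have q0 : (0 <= q)%R by rewrite addr_ge0 ?mulr_ge0 ?invr_ge0// ltW.
pose c := (1 + 2 * L * (8 + 6 * L) ^+ 2 + 4 * (t + 2 / t))%R.
have L0 : (0 <= L)%R by apply: le_trans L1.
have c0 : (0 <= c)%R.
  by rewrite /c !addr_ge0// ?mulr_ge0// ?addr_ge0 ?exprn_ge0 ?divr_ge0 ?addr_ge0 ?mulr_ge0// ltW.
(* For [e <= 1] the powers [e ^+ 2] and [e ^+ 4] are at most [e], so the whole error is at most
   [e * B]; the final 1 makes [B] positive. *)
pose B := (16 * (c ^+ 2 + 8 * c * q) + 4 * n%:R ^+ 2 + 1)%R.
have B0 : (0 < B)%R.
  by rewrite /B ltr_wpDl// addr_ge0 ?mulr_ge0 ?addr_ge0 ?exprn_ge0 ?mulr_ge0.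
pose e := Num.min 1%R (r / B)%R.
have e0 : (0 < e)%R by rewrite lt_min ltr01 divr_gt0.
have e1 : (e <= 1)%R by rewrite ge_min lexx.
have eB : (e * B <= r)%R by rewrite -ler_pdivlMr// ge_min lexx orbT.
apply: (le_trans (truncation_component_le e n%:R i e0 (ler0n _ _))).
rewrite -/q -EFinD lee_fin.
have -> : ((1 + 2 * L * (8 + 6 * L) ^+ 2) * e ^+ 2 + 2 * (2 * q + 2 * (t + 2 / t) * e ^+ 2) =
  c * e ^+ 2 + 4 * q)%R by rewrite /c; ring.
have e2 : (e ^+ 2 <= e)%R by rewrite expr2 ler_piMl// ltW.
have e4 : (e ^+ 4 <= e)%R.
  by rewrite (exprM _ 2 2) expr2 (le_trans _ e2)// ler_piMl ?sqr_ge0// (le_trans e2).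
have -> : (16 * (c * e ^+ 2 + 4 * q) ^+ 2 + 4 * n%:R ^+ 2 * e ^+ 2 =
  256 * q ^+ 2 + (16 * c ^+ 2 * e ^+ 4 + (128 * c * q) * e ^+ 2 + (4 * n%:R ^+ 2) * e ^+ 2))%R by ring.
rewrite lerD2l (le_trans _ eB)//.
have -> : (e * B = 16 * c ^+ 2 * e + (128 * c * q) * e + (4 * n%:R ^+ 2) * e + e)%R.
  by rewrite /B; ring.
rewrite ler_wpDr ?(ltW e0)// !lerD// ler_wpM2l// ?mulr_ge0// ?exprn_ge0//.
Qed.

End Components.

(** Both sides are squared, with 64^2 = 4 * 1024. [a] stands for the L^4 norm of the field, [b] and
    [c] for the L^2 norms of the field and of its gradient. *)
Lemma sqr_le_of_exp4_le {R : realType} (a b c A F H : R) : 0 <= b -> 0 <= c ->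
  a ^+ 4 = A -> b ^+ 2 = F -> c ^+ 2 = H ->
  A <= 4 * 1024 * F * H -> a ^+ 2 <= 64 * b * c.
Proof.
move=> b0 c0 <- <- <- abc; have bc0 : 0 <= 64 * b * c by rewrite mulr_ge0// mulr_ge0.
rewrite -(@ler_pXn2r _ 2) ?nnegrE ?sqr_ge0// -exprM.
have -> // : (64 * b * c) ^+ 2 = 4 * 1024 * b ^+ 2 * c ^+ 2 by ring.
Qed.

(** * From the components to the vector field, and choice of the constant *)

Section Ladyzhenskaya.
Context {R : realType}.
Local Open Scope ereal_scope.

Lemma sqr_vabs (u : 'I_2 -> R * R -> R) p :
  (vabs u p ^+ 2 = u d0 p ^+ 2 + u d1 p ^+ 2)%R.
Proof.
rewrite /vabs big_ord_recl big_ord1 sqr_sqrtr//.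
by rewrite addr_ge0 ?sqr_ge0.
Qed.

Lemma sqr_gradabs (L : R) (u : 'I_2 -> R * R -> R) p :
  (gradabs L u p ^+ 2 =
   (wderiv L d0 (u d0) p ^+ 2 + wderiv L d1 (u d0) p ^+ 2) +
   (wderiv L d0 (u d1) p ^+ 2 + wderiv L d1 (u d1) p ^+ 2))%R.
Proof.
rewrite /gradabs sqr_sqrtr; last first.
  by apply: sumr_ge0 => i _; apply: sumr_ge0 => j _; exact: sqr_ge0.
rewrite big_ord_recl big_ord1; congr (_ + _)%R.
  by rewrite big_ord_recl big_ord1.
by rewrite big_ord_recl big_ord1.
Qed.

(** With [F] and [H] the squared L^2 norms of the field and of its gradient, the component bounds
    add up to a bound valid for all [t]; optimising [t] and taking a square root gives the constant
    64. *)
Lemma ladyzhenskaya_V (L : R) (u : 'I_2 -> R * R -> R) : (1 <= L)%R -> V L u ->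
  normL leb2 4 (Omega L) (vabs u) ^+ 2 <=
  64%:E * normL leb2 2 (Omega L) (vabs u) * normL leb2 2 (Omega L) (gradabs L u).
Proof.
move=> L1 Vu; have [uH1 _ _] := Vu; have mO := measurable_Omega L.
have mu_ j := inL2_measurable leb2 _ _ mO (uH1 j).1.
have mw k j := inL2_measurable leb2 _ _ mO (is_wderiv_wderiv _ j _ (uH1 k)).1.
have uy j := inL2_integral_sqr_lty leb2 _ _ (uH1 j).1.
have wy k j := inL2_integral_sqr_lty leb2 _ _ (is_wderiv_wderiv _ j _ (uH1 k)).1.
have m2 (h : R * R -> R) : measurable_fun (Omega L) h -> measurable_fun (Omega L) (fun p => (h p ^+ 2)%:E).
  by move=> mh; apply/measurable_EFinP; exact: measurable_funX.
have sq0 (h : R * R -> R) p : Omega L p -> 0 <= (h p ^+ 2)%:E by rewrite lee_fin sqr_ge0.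
have I0 (h : R * R -> R) : 0 <= \int[leb2]_(p in Omega L) (h p ^+ 2)%:E.
  by apply: integral_ge0; exact: sq0.
have split (h k : R * R -> R) : measurable_fun (Omega L) h -> measurable_fun (Omega L) k ->
    \int[leb2]_(p in Omega L) (h p ^+ 2 + k p ^+ 2)%:E =
    \int[leb2]_(p in Omega L) (h p ^+ 2)%:E + \int[leb2]_(p in Omega L) (k p ^+ 2)%:E.
  move=> mh mk.
  exact: (ge0_integralD leb2 mO (sq0 h) (m2 _ mh) (sq0 k) (m2 _ mk)).
have FE : \int[leb2]_(p in Omega L) (vabs u p ^+ 2)%:E =
    \int[leb2]_(p in Omega L) (u d0 p ^+ 2)%:E + \int[leb2]_(p in Omega L) (u d1 p ^+ 2)%:E.
  rewrite -(split _ _ (mu_ d0) (mu_ d1)); apply: eq_integral => p _; by rewrite sqr_vabs.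
have HE : \int[leb2]_(p in Omega L) (gradabs L u p ^+ 2)%:E =
    (\int[leb2]_(p in Omega L) (wderiv L d0 (u d0) p ^+ 2)%:E +
     \int[leb2]_(p in Omega L) (wderiv L d1 (u d0) p ^+ 2)%:E) +
    (\int[leb2]_(p in Omega L) (wderiv L d0 (u d1) p ^+ 2)%:E +
     \int[leb2]_(p in Omega L) (wderiv L d1 (u d1) p ^+ 2)%:E).
  pose G k p := (wderiv L d0 (u k) p ^+ 2 + wderiv L d1 (u k) p ^+ 2)%:E.
  have G0 k p : Omega L p -> 0 <= G k p by move=> _; rewrite lee_fin addr_ge0// sqr_ge0.
  have mG k : measurable_fun (Omega L) (G k).
    have mw2 j : measurable_fun (Omega L) (fun p => wderiv L j (u k) p ^+ 2)%R.
      by apply: measurable_funX; exact: mw.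
    by apply/measurable_EFinP; exact: (measurable_funD (mw2 d0) (mw2 d1)).
  have /= E := ge0_integralD leb2 mO (G0 d0) (mG d0) (G0 d1) (mG d1).
  transitivity (\int[leb2]_(p in Omega L) (G d0 p + G d1 p)).
    by apply: eq_integral => p _; rewrite sqr_gradabs EFinD.
  apply: (etrans E); congr (_ + _).
    exact: (split _ _ (mw d0 d0) (mw d0 d1)).
  exact: (split _ _ (mw d1 d0) (mw d1 d1)).
pose F := fine (\int[leb2]_(p in Omega L) (vabs u p ^+ 2)%:E).
pose H := fine (\int[leb2]_(p in Omega L) (gradabs L u p ^+ 2)%:E).
have FF : \int[leb2]_(p in Omega L) (vabs u p ^+ 2)%:E = F%:E.
  by rewrite /F fineK// ge0_fin_numE// FE lte_add_pinfty.
have HH : \int[leb2]_(p in Omega L) (gradabs L u p ^+ 2)%:E = H%:E.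
  rewrite /H fineK// ge0_fin_numE// HE.
  by apply: lte_add_pinfty; apply: lte_add_pinfty; exact: wy.
have F0 : (0 <= F)%R by rewrite -lee_fin -FF.
have H0 : (0 <= H)%R by rewrite -lee_fin -HH.
have ord2 (i : 'I_2) : i = d0 \/ i = d1.
  by case: i => [[|[|//]] ilt]; [left|right]; exact: val_inj.
have uF i : \int[leb2]_(p in Omega L) (u i p ^+ 2)%:E <= F%:E.
  by rewrite -FF FE; have [->|->] := ord2 i; [exact: leeDl|exact: leeDr].
have uH i : \int[leb2]_(p in Omega L) (wderiv L d0 (u i) p ^+ 2)%:E +
    \int[leb2]_(p in Omega L) (wderiv L d1 (u i) p ^+ 2)%:E <= H%:E.
  by rewrite -HH HE; have [->|->] := ord2 i; [apply: leeDl|apply: leeDr]; exact: adde_ge0.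
have u40 i p : Omega L p -> 0 <= (u i p ^+ 4)%:E by rewrite lee_fin (@exprn_even_ge0 _ 4).
have mu4 i : measurable_fun (Omega L) (fun p => (u i p ^+ 4)%:E).
  by apply/measurable_EFinP; apply: measurable_funX; exact: mu_.
pose A := \int[leb2]_(p in Omega L) (vabs u p ^+ 4)%:E.
have A0 : 0 <= A by apply: integral_ge0 => p _; rewrite lee_fin exprn_ge0// sqrtr_ge0.
(* Pointwise |u|^4 <= 2 (u_1^4 + u_2^4), so the constant is 2 (256 + 256) = 1024. *)
have At t : (0 < t)%R -> A <= (1024 * (t * F + H / t) ^+ 2)%:E.
  move=> t0; have comp := component_L4_le L t F H u L1 t0 Vu uF uH.
  apply: (@le_trans _ _ (2%:E * (\int[leb2]_(p in Omega L) (u d0 p ^+ 4)%:E +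
      \int[leb2]_(p in Omega L) (u d1 p ^+ 4)%:E))).
    have /= E1 := ge0_integralD leb2 mO (u40 d0) (mu4 d0) (u40 d1) (mu4 d1).
    have S0 p : Omega L p -> 0 <= (u d0 p ^+ 4)%:E + (u d1 p ^+ 4)%:E.
      by move=> Op; rewrite adde_ge0// u40.
    have /= E2 := ge0_integralZl_EFin leb2 mO S0 (emeasurable_funD (mu4 d0) (mu4 d1)) (ler0n R 2).
    rewrite -E1 -E2; apply: ge0_le_integral => //.
    - by move=> p _; rewrite lee_fin exprn_ge0// sqrtr_ge0.
    - apply/measurable_EFinP.
      have -> : (fun p => vabs u p ^+ 4)%R = (fun p => (u d0 p ^+ 2 + u d1 p ^+ 2) ^+ 2)%R.
        by apply/funext => p; rewrite -sqr_vabs -exprM.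
      have mu2 i : measurable_fun (Omega L) (fun p => u i p ^+ 2)%R.
        by apply: measurable_funX; exact: mu_.
      by apply: measurable_funX; exact: (measurable_funD (mu2 d0) (mu2 d1)).
    - by apply: measurable_funeM; exact: (emeasurable_funD (mu4 d0) (mu4 d1)).
    move=> p _; rewrite (exprM _ 2 2) sqr_vabs -EFinD -EFinM lee_fin.
    have := sqr_ge0 (u d0 p ^+ 2 - u d1 p ^+ 2)%R.
    have -> : (u d0 p ^+ 4 = u d0 p ^+ 2 ^+ 2)%R by rewrite -exprM.
    have -> : (u d1 p ^+ 4 = u d1 p ^+ 2 ^+ 2)%R by rewrite -exprM.
    by lra.
  apply: (@le_trans _ _ (2%:E * ((256 * (t * F + H / t) ^+ 2)%:E + (256 * (t * F + H / t) ^+ 2)%:E))).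
    by rewrite lee_wpmul2l ?lee_fin// leeD.
  by rewrite -EFinD -EFinM lee_fin; lra.
(* The bound at [t = 1] already shows that [A] is finite, so [fine A] represents it faithfully. *)
have Afin : A \is a fin_num.
  by rewrite ge0_fin_numE// (le_lt_trans (At _ ltr01))// ltry.
have A4 : (fine A <= 4 * 1024 * F * H)%R.
  apply: (le_of_le_weighted _ _ _ _ F0 H0 (ler0n R 1024)) => t t0.
  by rewrite -lee_fin fineK//; exact: At.
rewrite (normLE leb2 4)// !(normLE leb2 2)//.
have -> : \int[leb2]_(p in Omega L) (`|vabs u p| ^+ 4)%:E = (fine A)%:E.
  rewrite fineK//; apply: eq_integral => p _; rewrite -normrX ger0_norm//.
  by rewrite (@exprn_even_ge0 _ 4).
have -> : \int[leb2]_(p in Omega L) (`|vabs u p| ^+ 2)%:E = F%:E.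
  by rewrite -FF; apply: eq_integral => p _; rewrite real_normK ?num_real.
have -> : \int[leb2]_(p in Omega L) (`|gradabs L u p| ^+ 2)%:E = H%:E.
  by rewrite -HH; apply: eq_integral => p _; rewrite real_normK ?num_real.
rewrite !poweR_EFin -EFin_expe -!EFinM lee_fin.
have root (n : nat) (x : R) : (0 < n)%N -> (0 <= x)%R -> ((x `^ n%:R^-1) ^+ n = x)%R.
  move=> n0 x0; rewrite -powR_mulrn ?powR_ge0// -powRrM mulVf ?powRr1//.
  by rewrite pnatr_eq0 -lt0n.
exact: (sqr_le_of_exp4_le _ _ _ _ _ _ (powR_ge0 _ _) (powR_ge0 _ _)
  (root 4%N _ isT (fine_ge0 A0)) (root 2%N _ isT F0) (root 2%N _ isT H0) A4).
Qed.

End Ladyzhenskaya.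

Theorem lemma3p5 (R : realType) (mu k0 k1 : R) (mu_gt0 : 0 < mu) :
  exists C : R, 0 < C /\
    forall L : R, 1 <= L ->
    forall u : 'I_2 -> R * R -> R, W mu k0 k1 L u ->
    (normL leb2 4 (Omega L) (vabs u) ^+ 2 <=
     C%:E * normL leb2 2 (Omega L) (vabs u) * normL leb2 2 (Omega L) (gradabs L u))%E.
Proof.
exists 64; split; first by [].
by move=> L L1 u [Vu _ _]; exact: ladyzhenskaya_V.
Qed.
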